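(* Let $S\subseteq\mathbb{N}$ with $|S|=\infty$. Then the following are equivalent: (a) $S$ is rational MICP-R. (b) There exist a finite set $S_1\subset\mathbb{N}$ and a non-empty periodic set $S_2\subset\mathbb{N}$ such that $S=S_1\cup S_2$. (c) There exist a finite set $S_1\subset\mathbb{N}$, a non-empty finite set $S_0\subset\mathbb{N}$ and $u_0\in\mathbb{N}\setminus\{0\}$ such that $S=S_1\cup\big(S_0+\operatorname{intcone}(\{u_0\})\big)$. (d) There exist a finite set $S_1\subset\mathbb{N}$ and an infinite rational MILP-R set $S_2\subset\mathbb{N}$ such that $S=S_1\cup S_2$.
   Context: $\mathbb{N}=\{1,2,\dots\}$, $\mathbb{Z}_+=\{0,1,2,\dots\}$; $n\in\mathbb{N}$, $p,d\in\mathbb{Z}_+$; subsets of $\mathbb{N}$ are regarded as subsets of $\mathbb{R}$; the symbol $\subset$ does not exclude equality. For a finite set $U\subseteq\mathbb{Z}^n$, $\operatorname{intcone}(U)=\{\sum_{u\in U}\lambda_u u : \lambda\in\mathbb{Z}_+^U\}$; sums of sets are Minkowski sums. A set $T\subseteq\mathbb{R}^n$ is periodic if there exists $u\in\mathbb{R}^n\setminus\{0\}$ such that $x+\lambda u\in T$ for all $x\in T$ and $\lambda\in\mathbb{N}$. A closed convex set $M\subseteq\mathbb{R}^{n+p+d}$ (with $d$) induces an MICP formulation of $S\subseteq\mathbb{R}^n$ if for every $x\in\mathbb{R}^n$: $x\in S$ iff there exist $y\in\mathbb{R}^p$, $z\in\mathbb{Z}^d$ with $(x,y,z)\in M$. $S$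 is rational MILP-R if it has an MICP formulation induced by a rational polyhedron $M$ (a polyhedron defined by finitely many linear inequalities with rational coefficients and right-hand sides). The index set of the formulation is $I=\operatorname{proj}_z(M)\subseteq\mathbb{R}^d$, the projection onto the last $d$ coordinates. For a convex (not necessarily closed) set $C\subseteq\mathbb{R}^d$, its recession cone is $C_\infty=\{r\in\mathbb{R}^d : x+\lambda r\in C\ \ \forall x\in C,\ \lambda\ge 0\}$. A convex set $I\subseteq\mathbb{R}^d$ is rationally unbounded if for every image $I'\subseteq\mathbb{R}^{d'}$ of $I$ under a rational affine map (a map $z\mapsto Az+b$ with $A,b$ having rational entries), either $I'$ is bounded or $\mathbb{Z}^{d'}\cap(I'_\infty\setminus\{0\})\neq\emptyset$. The set $S$ is rational MICP-R if it has an MICP formulation induced by some closed convex $M$ whose index set is rationally unbounded. *)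

(* Defs.v *)
From HB Require Import structures.
From mathcomp Require Import all_boot all_order all_algebra finmap.
From mathcomp Require Import all_classical all_reals all_analysis.

Set Implicit Arguments.
Unset Strict Implicit.
Unset Printing Implicit Defensive.

Import Order.TTheory GRing.Theory Num.Theory.
Import numFieldNormedType.Exports.

Local Open Scope classical_set_scope.
Local Open Scope ring_scope.

(* Points of R^n are column vectors, and R^(n+p+d) is 'cV[R]_(n + p + d), whose
   elements are written col_mx (col_mx x y) z. *)

Definition int_vec (R : realType) (n : nat) (z : 'cV[int]_n) : 'cV[R]_n :=
  map_mx intr z.
Arguments int_vec R {n} z.

(* N = {1, 2, ...} as a subset of R^1. *)
Definition posnats (R : realType) : set 'cV[R]_1 :=
  [set const_mx k%:R | k in [set k : nat | (0 < k)%N]].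
Arguments posnats R : clear implicits.

Definition intcone (n : nat) (U : {fset 'cV[int]_n}) : set 'cV[int]_n :=
  [set \sum_(u <- U) u *+ lam u | lam in [set: 'cV[int]_n -> nat]].

Definition minkowski_sum (R : realType) (n : nat) (A B : set 'cV[R]_n) :
    set 'cV[R]_n :=
  [set x + y | x in A & y in B].

Definition periodic_set (R : realType) (n : nat) (T : set 'cV[R]_n) : Prop :=
  exists2 u : 'cV[R]_n, u != 0 &
    forall (x : 'cV[R]_n) (k : nat), T x -> (0 < k)%N -> T (x + k%:R *: u).

Definition rational_polyhedron (R : realType) (k : nat) (M : set 'cV[R]_k) :
    Prop :=
  exists (m : nat) (A : 'M[rat]_(m, k)) (b : 'cV[rat]_m),
    M = [set w | forall i, (map_mx ratr A *m w) i 0 <= ratr (b i 0)].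

Definition MICP_formulation (R : realType) (n p d : nat)
    (M : set 'cV[R]_(n + p + d)) (S : set 'cV[R]_n) : Prop :=
  [/\ closed M,
      convex_set (M : set (convex_lmodType 'cV[R]_(n + p + d))) &
      forall x : 'cV[R]_n,
        S x <-> exists (y : 'cV[R]_p) (z : 'cV[int]_d),
                  M (col_mx (col_mx x y) (int_vec R z))].

Definition index_set (R : realType) (n p d : nat)
    (M : set 'cV[R]_(n + p + d)) : set 'cV[R]_d :=
  [set dsubmx w | w in M].

Definition recession_cone (R : realType) (d : nat) (C : set 'cV[R]_d) :
    set 'cV[R]_d :=
  [set r | forall (x : 'cV[R]_d) (lam : R), C x -> 0 <= lam -> C (x + lam *: r)].

Definition rationally_unbounded (R : realType) (d : nat) (I : set 'cV[R]_d) :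
    Prop :=
  forall (d' : nat) (A : 'M[rat]_(d', d)) (b : 'cV[rat]_d'),
    let I' := [set map_mx ratr A *m z + map_mx ratr b | z in I] in
    bounded_set I' \/
    range (int_vec R) `&` (recession_cone I' `\ 0) !=set0.

Definition rational_MICP_R (R : realType) (n : nat) (S : set 'cV[R]_n) : Prop :=
  exists (p d : nat) (M : set 'cV[R]_(n + p + d)),
    MICP_formulation M S /\ rationally_unbounded (index_set M).

Definition rational_MILP_R (R : realType) (n : nat) (S : set 'cV[R]_n) : Prop :=
  exists (p d : nat) (M : set 'cV[R]_(n + p + d)),
    MICP_formulation M S /\ rational_polyhedron M.

(* Main.v *)
Require Import Defs.
From mathcomp Require Import all_boot all_order all_algebra finmap.
From mathcomp Require Import all_classical all_reals all_analysis.
From mathcomp Require Import zify ring lra.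

Set Implicit Arguments.
Unset Strict Implicit.
Unset Printing Implicit Defensive.

Import Order.TTheory GRing.Theory Num.Theory.
Import numFieldNormedType.Exports.

Local Open Scope classical_set_scope.
Local Open Scope ring_scope.

(** The heart is that a rational MICP-R set of natural numbers is finite up to a
    periodic set. Let [I] be the index set of a formulation. Over each integer
    point [z] of [I] the formulation describes a convex set of natural numbers,
    that is a single number [f z], and convexity makes [f] compatible with
    midpoints ([MICP_fibers]).

    If [I] is unbounded it has integer recession directions, along which [f] is
    affine. Killing such a direction by a rational projection gives another image
    of [I], to which rational unboundedness applies again, until the image is
    bounded ([tower_exhausts]). As images of [I] may fail to be closed, a direction
    found at some stage recedes only modulo the previous ones; this is recorded
    by [recession_tower], and still suffices to extend [f] to full cosets of the
    lattice spanned by all directions found, where it is affine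
    ([tower_extends], [additive_of_midpoints]). The final image being bounded,
    the integer points of [I] lie in finitely many cosets
    ([finitely_many_classes]). On a coset where [f] is not constant, the first
    direction with nonzero slope, corrected by the previous ones to remain in
    [I], shows that the values of [f] there are closed under a fixed positive
    shift ([tower_period]). So [S] is a finite union of points and of
    shift-closed sets, which gives (b).

    A periodic set of natural numbers is generated by the least elements of its
    residue classes modulo a period ([periodic_generated]), which gives (c). The
    sets [S0 + intcone {u0}] are encoded by a polyhedron whose integer variables
    choose an element of [S0] as a vertex of a simplex and a multiplicity
    ([rational_MILP_progressions]), which gives (d).

    For (d) to (a), an infinite MILP-R set of natural numbers is itself periodic:
    after elimination of the continuous variables ([fourier_motzkin]) the slacks
    of the inequalities are, up to a common factor, natural numbers, so Dickson's
    lemma yields two solutions whose difference is a recession direction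
    ([MILP_periodic]). Hence [S] is again a union of finitely many points and
    finitely many progressions with the same step, and it remains to formulate
    such a union ([rational_MICP_progressions]). The index set is the product of
    a half-line and a simplex, which is rationally unbounded for elementary
    reasons; a pair of rotated second-order cones blocks the multiplicity at the
    vertices that stand for isolated points. *)

(** * Shift-closed sets of natural numbers *)

Definition shift_closed (p : nat) (E : set nat) : Prop :=
  forall k, E k -> E (k + p)%N.

Lemma shift_closed_mul p q E : shift_closed p E -> shift_closed (q * p) E.
Proof.
move=> Ep k Ek; elim: q => [|q IHq]; first by rewrite mul0n addn0.
by rewrite mulSnr addnA; exact: Ep.
Qed.

(** The product of the periods of the infinite members is a common period of
    their union. *)
Lemma finite_or_closed_bigcup (K : finType) (T : K -> set nat) :
  (forall i, finite_set (T i) \/ exists2 p, (0 < p)%N & shift_closed p (T i)) ->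
  exists (F P : set nat) (p : nat),
    [/\ finite_set F, (0 < p)%N, shift_closed p P &
        \bigcup_i T i = F `|` P].
Proof.
move=> HT.
pose fin i := `[< finite_set (T i) >].
have /choice[q Hq] : forall i, exists q, (0 < q)%N /\
    (~~ fin i -> shift_closed q (T i)).
  move=> i; have [Ti|[q q0 qT]] := HT i; last by exists q.
  by exists 1%N; split => // /asboolPn.
exists (\bigcup_(i in [set i | fin i]) T i).
exists (\bigcup_(i in [set i | ~~ fin i]) T i), (\prod_i q i)%N; split.
- by apply: bigcup_finite => [|i /asboolP]; first exact: finite_finset.
- by rewrite prodn_gt0// => i; case: (Hq i).
- move=> k [i/= Ni Tk]; exists i => //.
  rewrite (bigD1 i)//= mulnC; apply: shift_closed_mul => //.
  by case: (Hq i) => _; exact.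
- apply/seteqP; split=> k.
    move=> [i _ Tk]; have [Fi|Fi] := boolP (fin i); [left|right]; by exists i.
  by case=> -[i _ Tk]; exists i.
Qed.

(** The generators are the least elements of the residue classes modulo [p]
    that [P] meets; there are finitely many because reduction modulo [p] is
    injective on them. *)
Lemma shift_closed_generated p P : (0 < p)%N -> shift_closed p P ->
  exists G : set nat, [/\ G `<=` P, finite_set G &
    forall k, P k <-> exists2 g, G g & exists q, k = (g + q * p)%N].
Proof.
move=> p0 Pp.
pose G : set nat := [set g | P g /\ forall h, P h -> h = g %[mod p] -> (g <= h)%N].
have GP : G `<=` P by move=> g [].
exists G; split => //.
  apply: (@card_le_finite _ _ _ `I_p); last exact: finite_II.
  apply/pcard_leP; rewrite injfunPex; exists (modn^~ p) => [x _|x y].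
    exact: ltn_pmod.
  move=> /[!inE] -[Px xmin] [Py ymin] e.
  by apply/eqP; rewrite eqn_leq xmin ?ymin.
move=> k; split=> [|[g /GP Pg [q ->]]]; last exact: shift_closed_mul.
move=> Pk.
pose Q h := `[< P h /\ h = k %[mod p] >].
have exQ : exists h, Q h by exists k; apply/asboolP.
case: (ex_minnP exQ) => m /asboolP[Pm em] mmin.
have mk : (m <= k)%N by apply: mmin; apply/asboolP.
exists m.
  split=> // h Ph eh; apply: mmin; apply/asboolP; split => //.
  by rewrite eh.
exists ((k - m) %/ p)%N; rewrite divnK ?subnKC//.
by rewrite -eqn_mod_dvd// em.
Qed.

(** * Integer vectors and denominators *)

Lemma int_vecD (R : realType) (d : nat) (u v : 'cV[int]_d) :
  int_vec R (u + v) = int_vec R u + int_vec R v.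
Proof. exact: map_mxD. Qed.

Lemma int_vecMn (R : realType) (d : nat) (u : 'cV[int]_d) (n : nat) :
  int_vec R (u *+ n) = n%:R *: int_vec R u.
Proof. by rewrite /int_vec raddfMn/= scaler_nat. Qed.

Lemma int_vec_mulmx (R : realType) (m d : nat) (A : 'M[int]_(m, d))
    (z : 'cV[int]_d) :
  int_vec R (A *m z) = map_mx intr A *m int_vec R z.
Proof. exact: map_mxM. Qed.

Lemma ratr_map_intr (R : realType) (m n : nat) (A : 'M[int]_(m, n)) :
  map_mx ratr (map_mx intr A : 'M[rat]_(m, n)) = map_mx intr A :> 'M[R]_(m, n).
Proof. by rewrite -map_mx_comp; apply/matrixP => i j; rewrite !mxE/= ratr_int. Qed.

Lemma map_intr_inj (F : numFieldType) (m n : nat) :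
  injective (map_mx intr : 'M[int]_(m, n) -> 'M[F]_(m, n)).
Proof.
move=> A B /matrixP AB; apply/matrixP => i j; have := AB i j; rewrite !mxE.
exact: intr_inj.
Qed.

Lemma clear_denominators (m n : nat) (A : 'M[rat]_(m, n)) :
  exists2 D : nat, (0 < D)%N &
    exists A' : 'M[int]_(m, n), D%:R *: A = map_mx intr A'.
Proof.
pose D := (\prod_i \prod_j `|denq (A i j)|)%N.
exists D.
  by do 2!rewrite prodn_gt0// => ?; rewrite absz_gt0 denq_neq0.
have HA i j : D%:R * A i j \is a Num.int.
  rewrite /D (bigD1 i)//= (bigD1 j)//= -mulnA mulnC natrM -mulrA.
  rewrite rpredM ?natr_int// -{2}(divq_num_den (A i j)) natr_absz gtr0_norm ?denq_gt0//.
  by rewrite mulrCA divff ?intr_eq0 ?denq_neq0// mulr1 intr_int.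
exists (\matrix_(i, j) Num.floor (D%:R * A i j)).
by apply/matrixP => i j; rewrite !mxE floorK.
Qed.

(** * Midpoint-affine functions *)
(** The affine functions that arise live on the integer points of a convex set,
    where a general convex combination of two points makes no sense; a midpoint
    does, as soon as it is an integer point. *)
Definition midpoint_affine (R : realType) (d : nat) (D : set 'cV[R]_d)
    (g : 'cV[int]_d -> R) : Prop :=
  forall u v w, D (int_vec R u) -> D (int_vec R v) -> D (int_vec R w) ->
    u + v = w *+ 2 -> g u + g v = g w *+ 2.

Lemma recession_int (R : realType) (d : nat) (D : set 'cV[R]_d)
    (r z : 'cV[int]_d) (n : nat) :
  recession_cone D (int_vec R r) -> D (int_vec R z) ->
  D (int_vec R (z + r *+ n)).
Proof. by move=> rD Dz; rewrite int_vecD int_vecMn; exact: rD. Qed.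

(** The second differences of [g] along the ray vanish. *)
Lemma affine_along_recession (R : realType) (d : nat) (D : set 'cV[R]_d)
    (r : 'cV[int]_d) (g : 'cV[int]_d -> R) (z : 'cV[int]_d) (n : nat) :
  recession_cone D (int_vec R r) -> midpoint_affine D g -> D (int_vec R z) ->
  g (z + r *+ n) = g z + (g (z + r) - g z) *+ n.
Proof.
move=> rD gD Dz; pose a k := g (z + r *+ k).
have a2 k : a k + a k.+2 = a k.+1 *+ 2.
  apply: gD; try exact: recession_int.
  by rewrite mulrnDl -mulrnA addrACA -mulrnDr -mulr2n; congr (_ + _ *+ _); lia.
suff: a n = a 0%N + (a 1%N - a 0%N) *+ n /\
      a n.+1 = a 0%N + (a 1%N - a 0%N) *+ n.+1.
  by rewrite /a mulr0n addr0 mulr1n => -[].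
elim: n => [|n [IH1 IH2]]; first by rewrite mulr0n mulr1n addr0 addrC subrK.
split=> //; have := a2 n; rewrite {}IH1 {}IH2 !mulrSr mulr0n add0r; lra.
Qed.

(** A point [z] of [D'] enters [D] when it is moved far enough along [r], and
    from there on [g] is affine: [g (z + n r) = a + c n] for all large [n]. The
    constant term [a] is the value at [z] of the extension. The midpoint
    equations hold between these eventual expressions, hence between their
    constant terms. *)
Lemma extend_midpoint_affine (R : realType) (d : nat) (D D' : set 'cV[R]_d)
    (r : 'cV[int]_d) (g : 'cV[int]_d -> R) :
  recession_cone D (int_vec R r) -> midpoint_affine D g ->
  (forall z, D' (int_vec R z) -> exists n, D (int_vec R (z + r *+ n))) ->
  exists2 g', midpoint_affine D' g' &
    forall z, D (int_vec R z) -> g' z = g z.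
Proof.
move=> rD gD DD'.
pose eventually_line z (a : R) := exists c n0,
  forall n, (n0 <= n)%N -> D (int_vec R (z + r *+ n)) /\ g (z + r *+ n) = a + c *+ n.
have lineD z : D (int_vec R z) -> eventually_line z (g z).
  move=> Dz; exists (g (z + r) - g z), 0%N => n _; split; first exact: recession_int.
  exact: affine_along_recession rD gD Dz.
have lineD' z : D' (int_vec R z) -> exists a, eventually_line z a.
  move=> /DD'[n0 Dz]; have [c [n1 Hc]] := lineD _ Dz.
  exists (g (z + r *+ n0) - c *+ n0), c, (n0 + n1)%N => n len.
  have -> : n = (n0 + (n - n0))%N by lia.
  have [|H1 H2] := Hc (n - n0)%N; first by lia.
  rewrite mulrnDr addrA; split=> //.
  by rewrite H2 mulrnDr addrA subrK.
have /choice[g' Hg'] : forall z, exists a,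
    (exists a, eventually_line z a) -> eventually_line z a.
  by move=> z; have [[a Ha]|nE] := pselect (exists a, eventually_line z a);
    [exists a | exists 0].
have const_term0 (a c : R) n : a + c *+ n = 0 -> a + c *+ n.+1 = 0 -> a = 0.
  rewrite mulrSr => H1; rewrite addrA H1 add0r => c0.
  by move: H1; rewrite c0 mul0rn addr0.
exists g' => [u v w Du Dv Dw uvw|z Dz].
- have [cu [nu Hu]] := Hg' _ (lineD' _ Du).
  have [cv [nv Hv]] := Hg' _ (lineD' _ Dv).
  have [cw [nw Hw]] := Hg' _ (lineD' _ Dw).
  pose n0 := (nu + nv + nw)%N.
  have E n : (n0 <= n)%N -> (g' u + g' v - g' w *+ 2) + (cu + cv - cw *+ 2) *+ n = 0.
    move=> len.
    have [|Du1 eu] := Hu n; first by rewrite /n0 in len; lia.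
    have [|Dv1 ev] := Hv n; first by rewrite /n0 in len; lia.
    have [|Dw1 ew] := Hw n; first by rewrite /n0 in len; lia.
    have := gD _ _ _ Du1 Dv1 Dw1.
    rewrite eu ev ew => /(_ _)/eqP; rewrite -subr_eq0 => H.
    apply/eqP; rewrite -[X in X == _]/(_ + _).
    rewrite mulrnBl mulrnDl -mulrnA mulnC mulrnA.
    have -> : g' u + g' v - g' w *+ 2 + (cu *+ n + cv *+ n - cw *+ n *+ 2) =
      g' u + cu *+ n + (g' v + cv *+ n) - (g' w + cw *+ n) *+ 2 by ring.
    apply: H.
    by rewrite mulrnDl -uvw addrACA -mulr2n.
  apply/eqP; rewrite -subr_eq0; apply/eqP.
  by apply: (const_term0 _ (cu + cv - cw *+ 2) n0); apply: E.
- have Lz := lineD _ Dz.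
  have [c [n0 H]] := Hg' z (ex_intro _ _ Lz).
  have [c' [n1 H']] := Lz.
  apply/eqP; rewrite -subr_eq0; apply/eqP.
  have E n : (n0 + n1 <= n)%N -> (g' z - g z) + (c - c') *+ n = 0.
    move=> len; rewrite mulrnBl addrACA -opprD.
    have [|_ <-] := H n; first by lia.
    by have [|_ <-] := H' n; [lia | rewrite subrr].
  by apply: (const_term0 _ (c - c') (n0 + n1)%N); apply: E.
Qed.

(** * Towers of recession directions *)

Definition thicken (R : realType) (d m : nat) (I : set 'cV[R]_d)
    (B : 'M[int]_(d, m)) : set 'cV[R]_d :=
  [set x + map_mx intr B *m k | x in I & k in [set: 'cV[R]_m]].

(** The set [I] need not be closed, so a direction found in a rational image of
    [I] lifts only to a recession direction of [I] thickened by the directions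
    that the image kills, not to one of [I] itself. Hence the nesting: each new
    column recedes in the set thickened by the previous ones. *)
Inductive recession_tower (R : realType) (d : nat) (I : set 'cV[R]_d) :
    forall m, 'M[int]_(d, m) -> Prop :=
| RecessionTower0 (B : 'M[int]_(d, 0)) : recession_tower I B
| RecessionTowerS m (B : 'M[int]_(d, m)) (r : 'cV[int]_d) :
    recession_tower I B -> recession_cone (thicken I B) (int_vec R r) ->
    recession_tower I (row_mx r B).

Lemma thicken_mx0 (R : realType) (d : nat) (I : set 'cV[R]_d)
    (B : 'M[int]_(d, 0)) : thicken I B = I.
Proof.
apply/seteqP; split=> [_ [x Ix [k _ <-]]|x Ix].
  by rewrite (flatmx0 k) mulmx0 addr0.
by exists x => //; exists 0 => //; rewrite mulmx0 addr0.
Qed.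

Lemma subset_thicken (R : realType) (d m : nat) (I : set 'cV[R]_d)
    (B : 'M[int]_(d, m)) : I `<=` thicken I B.
Proof. by move=> x Ix; exists x => //; exists 0 => //; rewrite mulmx0 addr0. Qed.

(** Moving far along [r] makes the coefficient of [r] nonnegative, and
    nonnegative multiples of [r] are absorbed by [thicken I B]. *)
Lemma thicken_row_mx (R : realType) (d m : nat) (I : set 'cV[R]_d)
    (B : 'M[int]_(d, m)) (r z : 'cV[int]_d) :
  recession_cone (thicken I B) (int_vec R r) ->
  thicken I (row_mx r B) (int_vec R z) ->
  exists n, thicken I B (int_vec R (z + r *+ n)).
Proof.
move=> rB [x Ix [k _ Ez]]; rewrite -[k]vsubmxK map_row_mx mul_row_col in Ez.
set k1 := usubmx k in Ez; set k2 := dsubmx k in Ez.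
have Ek1 : map_mx intr r *m k1 = k1 0 0 *: int_vec R r.
  by rewrite [k1 in LHS]mx11_scalar mul_mx_scalar.
pose n := Num.bound `|k1 0 0|.
have n1 : 0 <= k1 0 0 + n%:R.
  have := archi_boundP (normr_ge0 (k1 0 0)); have := ler_norm (- k1 0 0).
  by rewrite normrN -/n; lra.
exists n; have -> : int_vec R (z + r *+ n) =
    (x + map_mx intr B *m k2) + (k1 0 0 + n%:R) *: int_vec R r.
  rewrite int_vecD int_vecMn -Ez Ek1 scalerDl -!addrA.
  by congr (_ + _); exact: addrCA.
by apply: rB => //; exists x => //; exists k2.
Qed.

(** Although [thicken I B] is obtained by real combinations of the columns, a
    lattice translation is enough to come back from one of its integer points
    to [I]: the columns are removed one at a time, each by a large integer
    multiple. *)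
Lemma tower_absorbs (R : realType) (d m : nat) (I : set 'cV[R]_d)
    (B : 'M[int]_(d, m)) (z : 'cV[int]_d) :
  recession_tower I B -> thicken I B (int_vec R z) ->
  exists k : 'cV[int]_m, I (int_vec R (z + B *m k)).
Proof.
move=> TB; elim: TB z => [{}B z|{}m {}B r TB IH rB z].
  by rewrite thicken_mx0 => Iz; exists 0; rewrite mulmx0 addr0.
move=> /(thicken_row_mx rB)[n /IH[k Ik]].
exists (col_mx (const_mx n%:Z) k); rewrite mul_row_col addrA.
suff -> : r *m const_mx n%:Z = r *+ n by [].
by apply/matrixP => i j; rewrite ord1 mxE big_ord1 mxE mulmxnE -mulr_natr natz.
Qed.

(** Once extended to the thickened set, a midpoint-affine function is defined on
    full cosets of the lattice spanned by [B], where it must be affine. *)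
Lemma tower_extends (R : realType) (d m : nat) (I : set 'cV[R]_d)
    (B : 'M[int]_(d, m)) (f : 'cV[int]_d -> R) :
  recession_tower I B -> midpoint_affine I f ->
  exists2 g, midpoint_affine (thicken I B) g &
    forall z, I (int_vec R z) -> g z = f z.
Proof.
move=> TB fI; elim: TB => [{}B|{}m {}B r TB [g gB gf] rB].
  by exists f => //; rewrite thicken_mx0.
have [g' g'B g'g] := extend_midpoint_affine rB gB
  (fun z => @thicken_row_mx _ _ _ _ _ _ z rB).
exists g' => // z Iz; rewrite g'g ?gf//; exact: subset_thicken.
Qed.

Lemma additive_intmul (U V : zmodType) (C : U -> V) (u : U) (n : int) :
  {morph C : x y / x + y} -> C (u *~ n) = C u *~ n.
Proof.
move=> CD.
have C0 : C 0 = 0 by apply: (addrI (C 0)); rewrite -CD !addr0.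
have Cn k : C (u *+ k) = C u *+ k.
  by elim: k => [|k IH]; rewrite ?mulr0n// !mulrS CD IH.
case: n => n; first by rewrite -!pmulrn.
rewrite NegzE !mulrNz -!pmulrn -Cn; apply/eqP.
by rewrite -subr_eq0 opprK -CD addNr C0.
Qed.

(** Take the first direction [r] of the tower that [C] does not kill. From a
    point of [I], one step along [r] can be corrected into [I] with the previous
    directions alone, which [C] ignores; so the value [c = C r] is the same for
    all starting points. *)
Lemma tower_period (R : realType) (d m : nat) (I : set 'cV[R]_d)
    (B : 'M[int]_(d, m)) (C : 'cV[int]_m -> R) :
  recession_tower I B -> {morph C : x y / x + y} ->
  C =1 (fun=> 0) \/
  exists2 c, c != 0 & forall z, I (int_vec R z) ->
    exists2 k, I (int_vec R (z + B *m k)) & C k = c.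
Proof.
move=> TB; elim: TB C => [{}B C CD|{}m {}B r TB IH rB C CD].
  left=> k; rewrite (flatmx0 k) -[X in C X](mulr0z 0).
  by rewrite additive_intmul.
pose e : 'cV[int]_(1 + m) := col_mx 1 0.
have Csplit k1 k2 : C (col_mx k1 k2) = C e *~ (k1 0 0) + C (col_mx 0 k2).
  rewrite -additive_intmul// -CD; congr C.
  rewrite -scaler_int intz scale_col_mx scaler0 add_col_mx addr0 add0r.
  by rewrite [k1 in LHS]mx11_scalar scalemx1.
have [|C0|[c c0 Hc]] := IH (C \o col_mx 0).
- by move=> x y /=; rewrite -CD add_col_mx addr0.
- have [Ce|Ce] := eqVneq (C e) 0; [left=> k|right].
    by rewrite -[k]vsubmxK Csplit Ce mul0rz [C _](C0 _) addr0.
  exists (C e) => // z Iz.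
  have [k Ik] : exists k : 'cV[int]_m, I (int_vec R ((z + r) + B *m k)).
    apply: (tower_absorbs TB); rewrite -(mulr1n r); apply: recession_int => //.
    exact: subset_thicken.
  exists (col_mx 1 k); first by rewrite mul_row_col mulmx1 addrA.
  by rewrite Csplit mxE eqxx mulr1z [C (col_mx 0 _)](C0 _) addr0.
- right; exists c => // z /Hc[k Ik Ck]; exists (col_mx 0 k) => //.
  by rewrite mul_row_col mulmx0 add0r.
Qed.

(** The kernel of [N] is the column space of [B] over every number field: it is
    used over the rationals, where denominators can be cleared, and over the
    reals, where [I] lives. *)
Definition cuts_out (d m : nat) (N : 'M[int]_d) (B : 'M[int]_(d, m)) : Prop :=
  N *m B = 0 /\
  forall (F : numFieldType) (u : 'cV[F]_d), map_mx intr N *m u = 0 ->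
    exists k : 'cV[F]_m, u = map_mx intr B *m k.

Lemma exists_cuts_out (d m : nat) (B : 'M[int]_(d, m)) :
  exists N : 'M[int]_d, cuts_out N B.
Proof.
pose Bq : 'M[rat]_(m, d) := (map_mx intr B)^T.
have [D D0 [N EN]] := clear_denominators (cokermx Bq)^T.
have Dn0 (F : numFieldType) : D%:R != 0 :> F by rewrite pnatr_eq0 -lt0n.
exists N; split.
  apply: (@map_intr_inj rat); rewrite map_mxM -EN -[map_mx intr B]trmxK.
  by rewrite -scalemxAl -trmx_mul mulmx_coker trmx0 scaler0 raddf0.
move=> F u Nu.
have EB : map_mx ratr Bq = (map_mx intr B)^T :> 'M[F]_(m, d).
  by apply/matrixP => i j; rewrite !mxE ratr_int.
have EN' : D%:R *: (cokermx (map_mx ratr Bq : 'M[F]_(m, d)))^T = map_mx intr N.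
  rewrite -map_cokermx; apply/matrixP => i j.
  have /matrixP/(_ i j) := EN; rewrite !mxE => /(congr1 (@ratr F)).
  by rewrite rmorphM/= ratr_int ratr_nat.
have /submxP[k Ek] : (u^T <= (map_mx ratr Bq : 'M[F]_(m, d)))%MS.
  rewrite submxE; apply/eqP/trmx_inj; rewrite trmx_mul trmxK trmx0.
  by apply: (scalerI (Dn0 F)); rewrite scalemxAl EN' Nu scaler0.
exists k^T; apply: trmx_inj; rewrite Ek EB trmx_mul trmxK; congr (_ *m _).
Qed.

(** If the image of [I] under [N] is unbounded, it has a nonzero integer
    recession direction [w]. Since [w] is a difference of two points of the
    image, the rational system [N rho = w] is solvable over the reals, hence
    over the rationals, and a multiple [r] of a rational solution is integer. A
    move along [r] stays in [I] up to the kernel of [N], which is what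
    thickening by [B] adds. *)
Lemma tower_step (R : realType) (d m : nat) (I : set 'cV[R]_d)
    (B : 'M[int]_(d, m)) (N : 'M[int]_d) :
  I !=set0 -> rationally_unbounded I -> cuts_out N B ->
  bounded_set [set map_mx intr N *m z | z in I] \/
  exists r : 'cV[int]_d, N *m r != 0 /\ recession_cone (thicken I B) (int_vec R r).
Proof.
move=> [x0 Ix0] Iru [NB0 NB]; have /= := Iru d (map_mx intr N) 0.
rewrite ratr_map_intr.
have -> : [set map_mx intr N *m z + map_mx ratr 0 | z in I] =
    [set map_mx intr N *m z | z in I].
  by apply/seteqP; split=> _ [z Iz <-]; exists z => //; rewrite raddf0 addr0.
case; [by left | move=> [_ [[w _ <-] [wI' /eqP w0]]]; right].
have [x1 Ix1 Ew] : [set map_mx intr N *m z | z in I]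
    (map_mx intr N *m x0 + 1 *: int_vec R w).
  by apply: wI' => //; exists x0.
rewrite scale1r in Ew.
have /submxP[rho Erho] : ((map_mx intr w : 'cV[rat]_d)^T <=
    (map_mx intr N : 'M[rat]_d)^T)%MS.
  rewrite -(map_submx (@ratr R)).
  have -> : map_mx ratr (map_mx intr w)^T = (int_vec R w)^T.
    by apply/matrixP => i j; rewrite !mxE ratr_int.
  have -> : map_mx ratr (map_mx intr N)^T = (map_mx intr N)^T :> 'M[R]_d.
    by apply/matrixP => i j; rewrite !mxE ratr_int.
  apply/submxP; exists (x1 - x0)^T; rewrite -trmx_mul mulmxBr Ew.
  by rewrite addrC addKr.
have [E E0 [r Er]] := clear_denominators rho^T.
have Nr : N *m r = w *+ E.
  apply: (@map_intr_inj rat); rewrite map_mxM -Er -scalemxAr raddfMn/=.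
  by rewrite -[map_mx intr w]trmxK Erho trmx_mul trmxK scaler_nat.
exists r; split.
  rewrite Nr; apply: contra w0 => /eqP/matrixP w0.
  apply/eqP/matrixP => i j; rewrite !mxE; have := w0 i j; rewrite mulmxnE mxE.
  by move/eqP; rewrite mulrn_eq0 eqn0Ngt E0/= => /eqP->.
move=> z lam [x Ix [k _ <-]] lam0.
have [x' Ix' Ex'] : [set map_mx intr N *m z | z in I]
    (map_mx intr N *m x + (lam * E%:R) *: int_vec R w).
  by apply: wI'; [exists x | rewrite mulr_ge0].
have [k' Ek'] : exists k' : 'cV[R]_m, x + lam *: int_vec R r - x' = map_mx intr B *m k'.
  apply: NB; rewrite mulmxBr mulmxDr Ex' -scalemxAr -int_vec_mulmx Nr int_vecMn.
  by rewrite scalerA subrr.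
exists x' => //; exists (k' + k) => //.
by rewrite mulmxDr -Ek' addrA [x' + _]addrC subrK addrAC.
Qed.

(** Each step of the tower enlarges the rational column space of [B], so the
    construction stops, and it can only stop when the image is bounded. *)
Lemma tower_exhausts (R : realType) (d : nat) (I : set 'cV[R]_d) :
  I !=set0 -> rationally_unbounded I ->
  exists m (B : 'M[int]_(d, m)) (N : 'M[int]_d),
    [/\ recession_tower I B, cuts_out N B &
        bounded_set [set map_mx intr N *m z | z in I]].
Proof.
move=> I0 Iru.
pose rk m (B : 'M[int]_(d, m)) := \rank (map_mx intr B : 'M[rat]_(d, m)).
suff H n : forall m (B : 'M[int]_(d, m)), recession_tower I B ->
    (d - rk m B < n)%N -> exists m (B : 'M[int]_(d, m)) (N : 'M[int]_d),
    [/\ recession_tower I B, cuts_out N B &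
        bounded_set [set map_mx intr N *m z | z in I]].
  by apply: (H d.+1 0%N 0); [exact: RecessionTower0 | rewrite ltnS leq_subr].
elim: n => // n IH m B TB rkB; have [N NB] := exists_cuts_out B.
have [bI|[r [Nr rB]]] := tower_step I0 Iru NB; first by exists m, B, N.
apply: (IH _ (row_mx r B)); first exact: RecessionTowerS.
suff : (rk _ B < rk _ (row_mx r B) <= d)%N by move: rkB; lia.
rewrite rank_leq_row andbT /rk -mxrank_tr -[X in (_ < X)%N]mxrank_tr.
rewrite map_row_mx tr_row_mx; apply: rank_ltmx.
rewrite ltmxE; apply/andP; split.
  by rewrite -addsmxE addsmxSr.
apply: contra Nr => rB'.
have /submxP[k /(congr1 trmx)] :
    ((map_mx intr r)^T <= (map_mx intr B : 'M[rat]_(d, m))^T)%MS.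
  by apply: submx_trans rB'; rewrite -addsmxE addsmxSl.
rewrite trmx_mul !trmxK => Er.
apply/eqP/(@map_intr_inj rat); rewrite map_mxM Er mulmxA -map_mxM NB.1.
by rewrite !raddf0 mul0mx.
Qed.

Lemma mx_entry_le_norm (R : realType) (m n : nat) (A : 'M[R]_(m, n)) i j :
  `|A i j| <= `|A|.
Proof.
rewrite [leRHS]mx_normrE.
exact: (@le_bigmax _ _ _ 0 (fun ij : 'I_m * 'I_n => `|A ij.1 ij.2|) (i, j)).
Qed.

(** The class of [z] is determined by the bounded integer vector [N z] together
    with [z] modulo [E], where [E] clears the denominators of a generalised
    inverse of [B]. If both agree for [z] and [z'], then [z' - z] is [E] times an
    integer vector and lies in the column space of [B], so its coordinates with
    respect to [B], given by the generalised inverse, are integers. *)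
Lemma finitely_many_classes (R : realType) (d m : nat) (I : set 'cV[R]_d)
    (B : 'M[int]_(d, m)) (N : 'M[int]_d) :
  cuts_out N B -> bounded_set [set map_mx intr N *m z | z in I] ->
  exists (K : finType) (h : 'cV[int]_d -> K), forall z z',
    I (int_vec R z) -> I (int_vec R z') -> h z = h z' ->
    exists k, z' = z + B *m k.
Proof.
move=> [_ NB] [M0 [M0r Mb]].
pose M := Num.max M0 0 + 1; pose T := Num.bound M.
have MT : M < T%:R by apply: archi_boundP; by rewrite addr_ge0// le_max lexx orbT.
have NT z i : I (int_vec R z) -> (`|(N *m z) i ord0| <= T%:Z)%R.
  move=> Iz; rewrite -(ler_int R) intr_norm.
  apply: le_trans (ltW MT).
  have -> : ((N *m z) i 0)%:~R = (map_mx intr N *m int_vec R z) i 0.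
    by rewrite -int_vec_mulmx [RHS]mxE.
  apply: le_trans (mx_entry_le_norm _ _ _) _.
  apply: (Mb M); last by exists (int_vec R z).
  by rewrite /M ltr_pwDr// le_max lexx.
have [E E0 [Q EQ]] := clear_denominators (pinvmx (map_mx intr B : 'M[rat]_(d, m))^T)^T.
(* The summand [T] makes the entries of [N z] nonnegative. *)
exists {ffun 'I_d -> 'I_(T + T).+1 * 'I_E.+1}.
exists (fun z : 'cV[int]_d => [ffun i => (inord `|((N *m z) i ord0 + T%:Z)%R|%N,
                                      inord `|(z i ord0 %% E%:Z)%Z|%N)]).
move=> z z' Iz Iz' /ffunP hzz'.
have Ni i : (N *m z) i 0 = (N *m z') i 0.
  have := hzz' i; rewrite !ffunE => -[/(congr1 val)/= + _].
  have := NT _ i Iz; have := NT _ i Iz'.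
  move: ((N *m z) i ord0) ((N *m z') i ord0) => x y.
  rewrite !ler_norml => /andP[y1 y2] /andP[x1 x2].
  by rewrite !inordK; [move=> /(congr1 Posz); rewrite !gez0_abs; lia|lia|lia].
have Zi i : (z i ord0 = z' i ord0 %[mod E])%Z.
  have := hzz' i; rewrite !ffunE => -[_ /(congr1 val)/=].
  have E1 : E%:Z != 0 by rewrite eqz_nat -lt0n.
  have H (x : int) : `|(x %% E)%Z|%N%:Z = (x %% E)%Z by rewrite gez0_abs ?modz_ge0.
  have L (x : int) : (`|(x %% E)%Z| < E.+1)%N.
    by rewrite -ltz_nat H; have := ltz_mod x E1; rewrite ger0_norm//; lia.
  by rewrite !inordK// => /(congr1 Posz); rewrite !H.
pose w : 'cV[int]_d := \col_i ((z' i ord0 - z i ord0)%R %/ E)%Z.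
have Ew : z' - z = w *+ E.
  apply/colP => i; rewrite mulmxnE !mxE -mulr_natr natz divzK//.
  by rewrite -eqz_mod_dvd; apply/eqP.
have [k Ek] : exists k : 'cV[rat]_m,
    map_mx intr (z' - z) = map_mx intr B *m k.
  apply: NB; rewrite -map_mxM mulmxBr.
  have -> : N *m z' - N *m z = 0.
    by apply/colP => i; rewrite mxE [X in _ + X]mxE Ni subrr mxE.
  by rewrite raddf0.
exists (Q *m w); apply/eqP; rewrite addrC -subr_eq; apply/eqP.
apply: (@map_intr_inj rat); rewrite !map_mxM -EQ -scalemxAl scalemxAr.
have -> : E%:R *: (map_mx intr w : 'cV[rat]_d) = map_mx intr (z' - z).
  by rewrite Ew raddfMn scaler_nat.
have /mulmxKpV H : ((map_mx intr (z' - z) : 'cV[rat]_d)^T <=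
    (map_mx intr B : 'M[rat]_(d, m))^T)%MS.
  by apply/submxP; exists k^T; rewrite -trmx_mul Ek.
by apply: trmx_inj; rewrite trmx_mul [X in _ = X *m _]trmx_mul trmxK; exact: esym H.
Qed.

(** * Values of midpoint-affine functions *)
Lemma additive_of_midpoints (R : realType) (d m : nat) (D : set 'cV[R]_d)
    (B : 'M[int]_(d, m)) (g : 'cV[int]_d -> R) (z : 'cV[int]_d) :
  midpoint_affine D g -> (forall k, D (int_vec R (z + B *m k))) ->
  {morph (fun k => g (z + B *m k) - g z) : k l / k + l}.
Proof.
move=> gD DB k l.
have mid u v w : u + v = w *+ 2 ->
    g (z + B *m u) + g (z + B *m v) = g (z + B *m w) *+ 2.
  move=> uvw; apply: gD => //.
  by rewrite addrACA -mulmxDr uvw mulrnDl raddfMn -mulr2n.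
have D0 u : g (z + B *m (u *+ 2)) + g z = g (z + B *m u) *+ 2.
  by have := mid (u *+ 2) 0 u (addr0 _); rewrite mulmx0 addr0.
have := mid (k *+ 2) (l *+ 2) (k + l) (esym (mulrnDl _ _ _)).
have := D0 k; have := D0 l; lra.
Qed.

(** A negative step [c] would give an infinite descent in [T]. *)
Lemma period_of_steps (R : realType) (T : set nat) (c : R) :
  T !=set0 -> c != 0 ->
  (forall n, T n -> exists2 n', T n' & n'%:R = n%:R + c) ->
  exists2 p, (0 < p)%N & shift_closed p T.
Proof.
move=> [n0 Tn0] c0 step.
have [cneg|cpos|c00] := ltgtP c 0; last by rewrite c00 eqxx in c0.
  suff noT n : forall k, (k < n)%N -> ~ T k by case: (noT n0.+1 n0 (ltnSn n0) Tn0).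
  elim: n => // n IH k kn Tk; have [k' Tk' Ek'] := step k Tk.
  have : (k' < k)%N by rewrite -(ltr_nat R) Ek'; lra.
  by move=> k'k; apply: (IH k') => //; lia.
have [n1 Tn1 En1] := step n0 Tn0.
have ltn01 : (n0 < n1)%N by rewrite -(ltr_nat R) En1; lra.
exists (n1 - n0)%N; first by rewrite subn_gt0.
move=> k /step[k' Tk' Ek']; suff <- : k' = (k + (n1 - n0))%N by [].
apply/eqP; rewrite -(eqr_nat R) natrD natrB; last exact: ltnW.
by rewrite Ek' En1; apply/eqP; lra.
Qed.

(** The integer points of [I] fall into finitely many cosets of the lattice
    spanned by [B]. On each of them [f] is the restriction of an affine function:
    if its linear part [C] is zero, [f] takes one value there; otherwise its set
    of values is closed under a fixed positive shift. *)
Lemma midpoint_affine_values (R : realType) (d : nat) (I : set 'cV[R]_d)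
    (f : 'cV[int]_d -> nat) :
  rationally_unbounded I -> midpoint_affine I (fun z => (f z)%:R) ->
  exists (F P : set nat) (p : nat),
    [/\ finite_set F, (0 < p)%N, shift_closed p P &
        [set f z | z in [set z | I (int_vec R z)]] = F `|` P].
Proof.
move=> Iru fI.
have [[z1 Iz1]|I0] := pselect (exists z, I (int_vec R z)); last first.
  exists set0, set0, 1%N; split=> //.
  by rewrite setU0 -subset0 => n [z Iz _]; case: I0; exists z.
have [m [B [N [TB NB bI]]]] : exists m (B : 'M[int]_(d, m)) (N : 'M[int]_d),
    [/\ recession_tower I B, cuts_out N B &
        bounded_set [set map_mx intr N *m z | z in I]].
  by apply: tower_exhausts => //; exists (int_vec R z1).
have [K [h Kh]] := finitely_many_classes NB bI.
have [g gB gf] := tower_extends TB fI.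
pose T (i : K) : set nat := [set f z' | z' in [set z' | I (int_vec R z') /\
   exists z k, [/\ I (int_vec R z), h z = i & z' = z + B *m k]]].
have -> : [set f z | z in [set z | I (int_vec R z)]] = \bigcup_i T i.
  apply/seteqP; split=> [_ [z /= Iz <-]|n [i _ [z [Iz _] <-]]]; last by exists z.
  exists (h z) => //; exists z => //; split=> //.
  by exists z, 0; rewrite mulmx0 addr0.
apply: finite_or_closed_bigcup => i.
have [[z0 [Iz0 hz0]]|nz] := pselect (exists z, I (int_vec R z) /\ h z = i); last first.
  left; suff -> : T i = set0 by [].
  rewrite -subset0 => n [z' [Iz' [z [k [Iz hz _]]]] _].
  by case: nz; exists z.
have TE z' : I (int_vec R z') ->
    (exists z k, [/\ I (int_vec R z), h z = i & z' = z + B *m k]) ->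
    exists k, z' = z0 + B *m k.
  move=> Iz' [z [k [Iz hz ->]]]; have [k' ->] := Kh _ _ Iz0 Iz (etrans hz0 (esym hz)).
  by exists (k' + k); rewrite mulmxDr addrA.
have thB k : thicken I B (int_vec R (z0 + B *m k)).
  exists (int_vec R z0) => //; exists (int_vec R k) => //.
  by rewrite int_vecD int_vec_mulmx.
have CD := additive_of_midpoints gB thB.
have fE k : I (int_vec R (z0 + B *m k)) ->
    (f (z0 + B *m k))%:R = (f z0)%:R + (g (z0 + B *m k) - g z0).
  by move=> Ik; rewrite -!gf// [RHS]addrC subrK.
have [C0|[c c0 Hc]] := tower_period TB CD.
  left; apply: (@sub_finite_set _ _ [set f z0]) => //.
  move=> _ [z' [Iz' /(TE _ Iz')[k Ek]] <-] /=.
  apply/eqP; rewrite -(eqr_nat R); apply/eqP.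
  by rewrite Ek in Iz' *; rewrite fE// [X in _ + X](C0 k) addr0.
right; apply: (@period_of_steps R _ c) => //.
  by exists (f z0), z0 => //; split=> //; exists z0, 0; rewrite mulmx0 addr0.
move=> _ [z' [Iz' /(TE _ Iz')[k Ek]] <-]; have [k' Ik' Ck'] := Hc _ Iz'.
rewrite {}Ek -addrA -mulmxDr in Iz' Ik' *.
exists (f (z0 + B *m (k + k'))).
  by exists (z0 + B *m (k + k')) => //; split=> //; exists z0, (k + k').
by rewrite !fE// [X in _ + X]CD Ck' addrA.
Qed.

(** * From formulations to periodic sets *)
Definition natpt (R : realType) (n : nat) : 'cV[R]_1 := const_mx n%:R.
Arguments natpt R n : clear implicits.

Lemma natpt_inj (R : realType) : injective (natpt R).
Proof.
by move=> m n /matrixP/(_ 0 0); rewrite !mxE => /eqP; rewrite eqr_nat => /eqP.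
Qed.

Lemma midpoint_convex (R : realType) (V : lmodType R) (A : set V) (u v w : V) :
  convex_set (A : set (convex_lmodType V)) -> A u -> A v -> u + v = w *+ 2 -> A w.
Proof.
move=> cA Au Av uvw.
have h0 : 0 <= 2^-1 :> R by lra.
have h1 : 2^-1 <= 1 :> R by lra.
have : A (2^-1 *: u + (1 - 2^-1) *: v).
  by have := cA u v (Itv01 h0 h1); rewrite !inE; exact.
have -> : 1 - 2^-1 = 2^-1 :> R by lra.
by rewrite -scalerDr uvw -[w *+ 2]scaler_nat scalerA mulVf ?pnatr_eq0// scale1r.
Qed.

(** The fiber of [M] over an integer point of the index set projects to a convex
    subset of [S], hence to a single natural number, since between two distinct
    ones there is a midpoint strictly closer to the first. Convexity of [M] makes
    this number a midpoint-affine function of the integer point. *)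
Lemma MICP_fibers (R : realType) (p d : nat) (M : set 'cV[R]_(1 + p + d))
    (S : set 'cV[R]_1) :
  S `<=` posnats R -> MICP_formulation M S ->
  exists f : 'cV[int]_d -> nat,
    midpoint_affine (index_set M) (fun z => (f z)%:R) /\
    S = natpt R @` [set f z | z in [set z | index_set M (int_vec R z)]].
Proof.
move=> SN [_ Mcvx SE].
pose fib z x := exists y, M (col_mx (col_mx x y) (int_vec R z)).
have fibS z x : fib z x -> S x by move=> [y My]; apply/SE; exists y, z.
have fibI z : index_set M (int_vec R z) -> exists n, fib z (natpt R n).
  move=> [w Mw wz].
  have wE : w =
      col_mx (col_mx (usubmx (usubmx w)) (dsubmx (usubmx w))) (int_vec R z).
    by rewrite -wz !vsubmxK.
  rewrite wE in Mw; have [n _ En] := SN _ (fibS z _ (ex_intro _ _ Mw)).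
  by exists n; exists (dsubmx (usubmx w)); rewrite /natpt En.
have fibmid z z' w x x' x'' : fib z x -> fib z' x' -> z + z' = w *+ 2 ->
    x + x' = x'' *+ 2 -> fib w x''.
  move=> [y My] [y' My'] zz' xx'; exists (2^-1 *: (y + y')).
  apply: (midpoint_convex Mcvx My My').
  rewrite !add_col_mx -int_vecD zz' xx' [RHS]mulr2n !add_col_mx -!mulr2n.
  rewrite int_vecMn scaler_nat; congr (col_mx (col_mx _ _) _).
  by rewrite -[RHS]scaler_nat scalerA divff ?pnatr_eq0// scale1r.
have fibuniq z k : forall n, fib z (natpt R n) -> fib z (natpt R (n + k)) -> k = 0%N.
  elim/ltn_ind: k => k IH n Fn Fnk; apply: contrapT => /eqP; rewrite -lt0n => k0.
  pose x : 'cV[R]_1 := const_mx (n%:R + k%:R / 2).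
  have Fx : fib z x.
    apply: fibmid Fn Fnk _ _; first by rewrite mulr2n.
    by apply/matrixP => i j; rewrite mulmxnE !mxE natrD; lra.
  have [l _ El] := SN _ (fibS _ _ Fx).
  have /matrixP/(_ 0 0) := El; rewrite !mxE => El'.
  have kR : 0 < k%:R :> R by rewrite ltr0n.
  have nl : (n < l)%N by rewrite -(ltr_nat R) El'; lra.
  have lk : (l < n + k)%N by rewrite -(ltr_nat R) El' natrD; lra.
  have : (l - n)%N = 0%N.
    apply: (IH (l - n)%N _ n) => //; first by lia.
    by rewrite subnKC 1?ltnW// /natpt El.
  lia.
have fibuniq2 z n n' : fib z (natpt R n) -> fib z (natpt R n') -> n = n'.
  move=> Fn Fn'; have [nn|/ltnW nn] := leqP n n'.
    by have := fibuniq z (n' - n)%N n Fn; rewrite subnKC// => /(_ Fn'); lia.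
  by have := fibuniq z (n - n')%N n' Fn'; rewrite subnKC// => /(_ Fn); lia.
have /choice[f Hf] : forall z, exists n,
    index_set M (int_vec R z) -> fib z (natpt R n).
  move=> z; have [/fibI[n Fn]|nI] := pselect (index_set M (int_vec R z)).
    by exists n.
  by exists 0%N.
exists f; split.
  move=> u v w Iu Iv Iw uvw.
  pose x : 'cV[R]_1 := const_mx (((f u)%:R + (f v)%:R) / 2).
  have Fx : fib w x.
    apply: fibmid (Hf _ Iu) (Hf _ Iv) uvw _.
    by apply/matrixP => i j; rewrite mulmxnE !mxE; lra.
  have [l _ El] := SN _ (fibS _ _ Fx).
  have /matrixP/(_ 0 0) := El; rewrite !mxE => El'.
  have -> : f w = l by apply: (fibuniq2 w); [exact: Hf | rewrite /natpt El].
  by rewrite El'; lra.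
apply/seteqP; split=> [x Sx|_ [_ [z Iz <-] <-]]; last exact: fibS (Hf _ Iz).
have [n _ En] := SN _ Sx.
have /SE[y [z My]] := Sx.
have Iz : index_set M (int_vec R z) by eexists; [exact: My|rewrite col_mxKd].
exists (f z); first by exists z.
rewrite -En; congr natpt; apply: (fibuniq2 z); first exact: Hf.
by exists y; rewrite /natpt En.
Qed.

Lemma rational_MICP_periodic (R : realType) (S : set 'cV[R]_1) :
  S `<=` posnats R -> infinite_set S -> rational_MICP_R S ->
  exists S1 S2 : set 'cV[R]_1,
    [/\ S1 `<=` posnats R /\ finite_set S1,
        [/\ S2 `<=` posnats R, S2 !=set0 & periodic_set S2] &
        S = S1 `|` S2].
Proof.
move=> SN Sinf [p [d [M [MS Iru]]]].
have [f [fI SE]] := MICP_fibers SN MS.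
have [F [P [q [Ffin q0 Pq FP]]]] := midpoint_affine_values Iru fI.
have SE' : S = natpt R @` F `|` natpt R @` P by rewrite SE FP image_setU.
have F1 : finite_set (natpt R @` F) by exact: finite_image.
exists (natpt R @` F), (natpt R @` P); split=> //.
- by split=> // x Fx; apply: SN; rewrite SE'; left.
- split.
  + by move=> x Px; apply: SN; rewrite SE'; right.
  + apply/set0P/negP => /eqP P0; apply: Sinf.
    by rewrite SE' P0 setU0.
  exists (natpt R q).
    by apply: contraTneq q0 => /(@natpt_inj R _ 0%N) ->.
  move=> _ k [n Pn <-] _; exists (n + k * q)%N; first exact: shift_closed_mul.
  by apply/matrixP => i j; rewrite !mxE natrD natrM.
Qed.

Lemma periodic_shift_closed (R : realType) (T : set 'cV[R]_1) :
  T `<=` posnats R -> T !=set0 -> periodic_set T ->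
  exists (P : set nat) (p : nat),
    [/\ (0 < p)%N, shift_closed p P & T = natpt R @` P].
Proof.
move=> TN T0 [u u0 uT].
pose P : set nat := [set n | T (natpt R n)].
have TE : T = natpt R @` P.
  apply/seteqP; split=> [x Tx|_ [n Pn <-]//].
  by have [n _ En] := TN _ Tx; exists n => //; rewrite /P/= /natpt En.
suff [p p0 Pp] : exists2 p, (0 < p)%N & shift_closed p P by exists P, p.
apply: (@period_of_steps R _ (u 0 0)).
- by move: T0; rewrite {1}TE => -[_ [n Pn _]]; exists n.
- apply: contra u0 => /eqP u00; apply/eqP/matrixP => i j.
  by rewrite !ord1 u00 mxE.
- move=> n /(uT _ 1%N)/(_ isT) Tn; have [n' _ En'] := TN _ Tn.
  exists n'; first by rewrite /P/= /natpt En'.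
  by have /matrixP/(_ 0 0) := En'; rewrite !mxE mul1r.
Qed.

Lemma intcone_single (R : realType) (u : nat) :
  int_vec R @` intcone [fset const_mx u%:Z]%fset =
  [set natpt R (q * u) | q in [set: nat]].
Proof.
apply/seteqP; split=> [_ [_ [lam _ <-] <-]|_ [q _ <-]].
  rewrite big_seq_fset1; exists (lam (const_mx u%:Z)) => //.
  by apply/matrixP => i j; rewrite !mxE mulmxnE mxE natrM mulr_natl rmorphMn.
exists (const_mx u%:Z *+ q); last first.
  by apply/matrixP => i j; rewrite !mxE mulmxnE mxE natrM mulr_natl rmorphMn.
by exists (fun=> q) => //; rewrite big_seq_fset1.
Qed.

Lemma periodic_generated (R : realType) (T : set 'cV[R]_1) :
  T `<=` posnats R -> T !=set0 -> periodic_set T ->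
  exists (S0 : set 'cV[R]_1) (u0 : nat),
    [/\ [/\ S0 `<=` posnats R, S0 !=set0 & finite_set S0], (0 < u0)%N &
        T = minkowski_sum S0 (int_vec R @` intcone [fset const_mx u0%:Z]%fset)].
Proof.
move=> TN T0 Tper; have [P [p [p0 Pp TE]]] := periodic_shift_closed TN T0 Tper.
have [G [GP Gfin PG]] := shift_closed_generated p0 Pp.
exists (natpt R @` G), p; split=> //.
  split; last exact: finite_image.
    by move=> _ [g /GP Pg <-]; apply: TN; rewrite TE; exists g.
  by move: T0; rewrite TE => -[_ [n /PG[g Gg _] _]]; exists (natpt R g), g.
rewrite TE intcone_single; apply/seteqP; split=> [_ [n /PG[g Gg [q ->]] <-]|].
  exists (natpt R g); first by exists g.
  exists (natpt R (q * p)); first by exists q.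
  by apply/matrixP => i j; rewrite !mxE natrD.
move=> _ [_ [g Gg <-] [_ [q _ <-] <-]].
exists (g + q * p)%N; first by apply/PG; exists g => //; exists q.
by apply/matrixP => i j; rewrite !mxE natrD.
Qed.

(** * Dickson's lemma and elimination of continuous variables *)

(** Pick successively the place of the minimum of the remaining tail. *)
Lemma nondecreasing_subseq (h : nat -> nat) :
  exists phi : nat -> nat, {homo phi : i j / (i < j)%N} /\
    forall i j, (i <= j)%N -> (h (phi i) <= h (phi j))%N.
Proof.
have /choice[s Hs] : forall n, exists k, (n <= k)%N /\
    forall j, (n <= j)%N -> (h k <= h j)%N.
  move=> n; pose Q v := `[< exists2 k, (n <= k)%N & h k = v >].
  have exQ : exists v, Q v by exists (h n); apply/asboolP; exists n.
  case: (ex_minnP exQ) => v /asboolP[k nk <-] vmin.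
  by exists k; split=> // j nj; apply: vmin; apply/asboolP; exists j.
pose phi := fix phi n := if n is n'.+1 then s (phi n').+1 else s 0%N.
have phiS i : (phi i < phi i.+1)%N by have [] := Hs (phi i).+1.
have phi_lt : {homo phi : i j / (i < j)%N}.
  by apply: homo_ltn => // ? ? ?; exact: ltn_trans.
have phi_min i j : (phi i <= j)%N -> (h (phi i) <= h j)%N.
  case: i => [|i] /= lej.
    by have [_] := Hs 0%N; apply.
  by have [le1 +] := Hs (phi i).+1; apply; exact: leq_trans le1 lej.
exists phi; split=> // i j; rewrite leq_eqVlt => /predU1P[->//|/phi_lt lt].
exact/phi_min/ltnW.
Qed.

Lemma nondecreasing_subseq_vector (m : nat) (q : nat -> 'I_m -> nat) :
  exists phi : nat -> nat, {homo phi : i j / (i < j)%N} /\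
    forall l i j, (i <= j)%N -> (q (phi i) l <= q (phi j) l)%N.
Proof.
elim: m q => [|m IH] q; first by exists id; split=> // -[].
have [phi [phi_lt phiq]] := IH (fun n l => q n (lift ord0 l)).
have [psi [psi_lt psiq]] := nondecreasing_subseq (fun n => q (phi n) ord0).
exists (phi \o psi); split=> [i j /psi_lt/phi_lt//|l i j lij /=].
case: (unliftP ord0 l) => [l' ->|->]; last exact: psiq.
by apply: phiq; move: lij; rewrite leq_eqVlt => /predU1P[->//|/psi_lt/ltnW].
Qed.

Lemma between_seqs (R : realType) (L U : seq R) :
  (forall l u, l \in L -> u \in U -> l <= u) ->
  exists t, (forall l, l \in L -> l <= t) /\ (forall u, u \in U -> t <= u).
Proof.
elim: L => [_|l0 L IH LU].
  elim: U => [|u0 U [t [_ Ht]]]; first by exists 0.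
  exists (Num.min u0 t); split=> // u; rewrite inE ge_min => /predU1P[->|/Ht ->].
    by rewrite lexx.
  by rewrite orbT.
have [|t [Lt tU]] := IH; first by move=> l u lL; apply: LU; rewrite inE lL orbT.
exists (Num.max l0 t); split=> [l|u uU].
  rewrite inE le_max => /predU1P[->|/Lt ->]; first by rewrite lexx.
  by rewrite orbT.
by rewrite ge_max tU// LU// mem_head.
Qed.

(** The rows of [V] combine one upper and one lower bound on the eliminated
    variable, or keep an inequality where it does not occur; they are indexed by
    the pairs of inequalities, the remaining pairs giving zero rows. *)
Lemma fourier_motzkin1 (R : realType) (m : nat) (a : 'cV[rat]_m) :
  exists m' (V : 'M[rat]_(m', m)), forall c : 'cV[R]_m,
    (exists t : R, forall i, ratr (a i 0) * t <= c i 0) <->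
    (forall i, 0 <= (map_mx ratr V *m c) i 0).
Proof.
pose v (ij : 'I_m * 'I_m) : 'rV[rat]_m := let: (i, j) := ij in
  if a i 0 == 0 then delta_mx 0 i else
  if (0 < a i 0) && (a j 0 < 0) then a i 0 *: delta_mx 0 j - a j 0 *: delta_mx 0 i
  else 0.
pose V : 'M[rat]_(#|{: 'I_m * 'I_m}|, m) := \matrix_k v (enum_val k).
exists #|{: 'I_m * 'I_m}|, V => c.
have deltaE i : (delta_mx (0 : 'I_1) i *m c) 0 0 = c i 0 by rewrite -rowE mxE.
have vE ij : (map_mx ratr (v ij) *m c) 0 0 = let: (i, j) := ij in
  if a i 0 == 0 then c i 0 else
  if (0 < a i 0) && (a j 0 < 0) then ratr (a i 0) * c j 0 - ratr (a j 0) * c i 0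
  else 0.
  case: ij => i j /=; case: ifP => _; first by rewrite map_delta_mx deltaE.
  case: ifP => _; last by rewrite map_mx0 mul0mx mxE.
  rewrite map_mxB !map_mxZ !map_delta_mx mulmxBl -!scalemxAl.
  by rewrite -!rowE !mxE.
have VE k : (map_mx ratr V *m c) k 0 =
    (map_mx ratr (v (enum_val k)) *m c) 0 0.
  by rewrite !mxE; apply: eq_bigr => j _; rewrite !mxE.
have -> : (forall k, 0 <= (map_mx ratr V *m c) k 0) <->
    (forall ij, 0 <= (map_mx ratr (v ij) *m c) 0 0).
  split=> [H ij|H k]; last by rewrite VE.
  by have := H (enum_rank ij : 'I_#|{: 'I_m * 'I_m}|); rewrite VE enum_rankK.
split=> [[t Ht] ij|H].
  rewrite vE; case: ij => i j; case: ifP => [/eqP ai0|_].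
    by have := Ht i; rewrite ai0 raddf0 mul0r.
  case: ifP => // /andP[ai aj].
  have := Ht i; have := Ht j.
  move: ai aj; rewrite -(ltr0q R) -(ltrq0 R); nra.
have [|t [Lt tU]] := @between_seqs R
  [seq c j 0 / ratr (a j 0) | j <- enum 'I_m & a j 0 < 0]
  [seq c i 0 / ratr (a i 0) | i <- enum 'I_m & 0 < a i 0].
  move=> _ _ /mapP[j + ->] /mapP[i + ->].
  rewrite !mem_filter => /andP[aj _] /andP[ai _].
  have := H (i, j); rewrite vE (gt_eqF ai) ai aj/=.
  move: ai aj; rewrite -(ltr0q R) -(ltrq0 R) => ai aj Hij.
  rewrite ler_pdivlMr// mulrAC ler_ndivrMr//; lra.
exists t => i; have [ai|ai|ai] := ltgtP (a i 0) 0.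
- rewrite mulrC -ler_ndivrMr ?ltrq0//; apply: Lt.
  by apply: (map_f (fun j => c j 0 / ratr (a j 0))); rewrite mem_filter ai mem_enum.
- rewrite mulrC -ler_pdivlMr ?ltr0q//; apply: tU.
  by apply: (map_f (fun j => c j 0 / ratr (a j 0))); rewrite mem_filter ai mem_enum.
- by have := H (i, i); rewrite vE ai eqxx raddf0 mul0r.
Qed.

(** The vector [c] stands for the part of the system in the variables that are
    kept, which enters only through linear combinations with rational
    coefficients. *)
Lemma fourier_motzkin (R : realType) (m p : nat) (A : 'M[rat]_(m, p)) :
  exists m' (V : 'M[rat]_(m', m)), forall c : 'cV[R]_m,
    (exists y : 'cV[R]_p, forall i, (map_mx ratr A *m y) i 0 <= c i 0) <->
    (forall i, 0 <= (map_mx ratr V *m c) i 0).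
Proof.
elim: p A => [|p IH] A.
  exists m, 1%:M => c; rewrite map_mx1 mul1mx; split=> [[y Hy] i|Hc].
    by have := Hy i; rewrite (flatmx0 y) mulmx0 mxE.
  by exists 0 => i; rewrite mulmx0 mxE.
pose A1 : 'M[rat]_(m, 1 + p) := A.
have [m1 [V1 HV1]] := IH (rsubmx A1).
have [m2 [V2 HV2]] := fourier_motzkin1 R (V1 *m lsubmx A1).
exists m2, (V2 *m V1) => c; rewrite map_mxM -mulmxA -HV2.
have E t : (forall i, ratr ((V1 *m lsubmx A1) i 0) * t <=
                      (map_mx ratr V1 *m c) i 0) <->
    exists y : 'cV[R]_p, forall i, (map_mx ratr (rsubmx A1) *m y) i 0 <=
      (c - t *: map_mx ratr (lsubmx A1)) i 0.
  have entryE i : (map_mx ratr V1 *m (c - t *: map_mx ratr (lsubmx A1))) i 0 =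
      (map_mx ratr V1 *m c) i 0 - ratr ((V1 *m lsubmx A1) i 0) * t.
    rewrite mulmxBr -scalemxAr -map_mxM [LHS]mxE.
    by rewrite [X in _ + X]mxE [X in _ - X]mxE [X in _ - _ * X]mxE mulrC.
  by rewrite HV1; split=> H i; have := H i; rewrite entryE subr_ge0.
have AE (y : 'cV[R]_(1 + p)) : map_mx ratr A1 *m y =
    usubmx y 0 0 *: map_mx ratr (lsubmx A1) + map_mx ratr (rsubmx A1) *m dsubmx y.
  rewrite -{1}[A1]hsubmxK map_row_mx -{1}[y]vsubmxK mul_row_col; congr (_ + _).
  by rewrite [usubmx y in LHS]mx11_scalar mul_mx_scalar.
split=> [[y Hy]|[t /E[y Hy]]].
  exists (usubmx (y : 'cV_(1 + p)) 0 0); apply/E.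
  exists (dsubmx (y : 'cV_(1 + p))) => i; have := Hy i; rewrite (AE y).
  rewrite [X in X <= _]mxE [X in _ -> _ <= X]mxE [X in _ -> _ <= _ + X]mxE; lra.
exists (col_mx t%:M y : 'cV_(1 + p)) => i.
have := Hy i; rewrite (AE (col_mx t%:M y)) col_mxKu col_mxKd.
rewrite [t%:M _ _]mxE eqxx mulr1n.
rewrite [X in _ <= X -> _]mxE [X in _ <= _ + X -> _]mxE [X in _ -> X <= _]mxE; lra.
Qed.

(** Dickson's lemma on the slack vectors of solutions with ever larger [n] gives
    two solutions, the second with larger [n] and with no smaller slack in any
    inequality. Their difference can then be added to every solution. *)
Lemma infinite_integer_slices (d m : nat) (beta xi : 'cV[int]_m)
    (Z : 'M[int]_(m, d)) (P : set nat) :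
  infinite_set P ->
  (forall n, P n <-> exists z : 'cV[int]_d,
     forall i, 0 <= (beta - xi *+ n - Z *m z) i 0) ->
  exists2 p, (0 < p)%N & shift_closed p P.
Proof.
move=> Pinf PE.
have /choice[e He] : forall n, exists ez : nat * 'cV[int]_d, (n < ez.1)%N /\
    forall i, 0 <= (beta - xi *+ ez.1 - Z *m ez.2) i 0.
  move=> n; apply: contrapT => H; apply: Pinf.
  apply: (@sub_finite_set _ _ `I_n.+1); last exact: finite_II.
  move=> k /PE[z Hz] /=; rewrite ltnS leqNgt; apply/negP => nk.
  by apply: H; exists (k, z).
pose s n := beta - xi *+ (e n).1 - Z *m (e n).2.
have [phi [phi_lt phis]] := nondecreasing_subseq_vector (fun n i => `|s n i ord0|%N).
have le_phi n : (n <= phi n)%N.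
  by elim: n => // n IH; apply: leq_ltn_trans IH _; exact: phi_lt.
(* As [e n > n], the index [(e i0).1] leads to a solution with larger [n]. *)
pose i0 := phi 0%N; pose j0 := phi (e i0).1.
have lt_e : ((e i0).1 < (e j0).1)%N.
  by apply: leq_ltn_trans (le_phi _) _; case: (He j0).
have le_s i : s i0 i 0 <= s j0 i 0.
  have s_ge0 n : 0 <= s n i 0 by have [_ /(_ i)] := He n.
  by have := phis i 0%N (e i0).1 (leq0n _); rewrite -lez_nat !gez0_abs.
exists ((e j0).1 - (e i0).1)%N; first by rewrite subn_gt0.
move=> k /PE[z Hz]; apply/PE; exists (z + ((e j0).2 - (e i0).2)) => i.
have -> : beta - xi *+ (k + ((e j0).1 - (e i0).1)) - Z *m (z + ((e j0).2 - (e i0).2)) =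
    (beta - xi *+ k - Z *m z) + (s j0 - s i0).
  rewrite /s mulmxDr mulmxBr mulrnDr mulrnBr ?(ltnW lt_e)//.
  move: (xi *+ k) (xi *+ (e j0).1) (xi *+ (e i0).1) => x1 x2 x3.
  move: (Z *m z) (Z *m (e j0).2) (Z *m (e i0).2) => z1 z2 z3.
  by apply/colP => l; rewrite !mxE; ring.
rewrite mxE addr_ge0// [X in 0 <= X]mxE [X in _ + X]mxE subr_ge0; exact: le_s.
Qed.

Lemma MILP_integer_slices (R : realType) (p d : nat)
    (M : set 'cV[R]_(1 + p + d)) (S : set 'cV[R]_1) :
  rational_polyhedron M -> MICP_formulation M S ->
  exists m (beta xi : 'cV[int]_m) (Z : 'M[int]_(m, d)), forall n : nat,
    S (natpt R n) <-> exists z : 'cV[int]_d,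
      forall i, 0 <= (beta - xi *+ n - Z *m z) i 0.
Proof.
move=> [m [A [b ->]]] [_ _ SE].
pose Ax := lsubmx (lsubmx A); pose Ay := rsubmx (lsubmx A); pose Az := rsubmx A.
have [m' [V HV]] := fourier_motzkin R Ay.
have [D D0 [W EW]] :=
  clear_denominators (row_mx (V *m b) (row_mx (V *m Ax) (V *m Az))).
exists m', (lsubmx W), (lsubmx (rsubmx W)), (rsubmx (rsubmx W)) => n.
have -> : S (natpt R n) <-> exists z : 'cV[int]_d, exists y : 'cV[R]_p,
    forall i, (map_mx ratr Ay *m y) i 0 <=
      (map_mx ratr b - map_mx ratr Ax *m natpt R n -
       map_mx ratr Az *m int_vec R z) i 0.
  rewrite SE; split=> [[y [z Myz]]|[z [y Myz]]]; [exists z, y => i|exists y, z => i];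
    have := Myz i; rewrite -{1}[A]hsubmxK -{1}[lsubmx A]hsubmxK;
    rewrite !map_row_mx !mul_row_col -/Ax -/Ay -/Az.
    move: (_ *m y) (_ *m natpt R n) (_ *m int_vec R z) => v1 v2 v3.
    by rewrite !mxE; lra.
  move: (_ *m y) (_ *m natpt R n) (_ *m int_vec R z) => v1 v2 v3.
  by rewrite !mxE; lra.
rewrite -[W]hsubmxK -[rsubmx W]hsubmxK !map_row_mx !scale_row_mx in EW.
have [/eq_row_mx[Eb /eq_row_mx[Ex Ez]]] := EW.
have DR (k : nat) (Q : 'M[rat]_(m', k)) (Q' : 'M[int]_(m', k)) :
    D%:R *: Q = map_mx intr Q' ->
    map_mx intr Q' = D%:R *: map_mx ratr Q :> 'M[R]_(m', k).
  by move=> /(congr1 (map_mx (@ratr R))); rewrite ratr_map_intr map_mxZ/= ratr_nat.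
have WE (z : 'cV[int]_d) :
    int_vec R (lsubmx W - lsubmx (rsubmx W) *+ n - rsubmx (rsubmx W) *m z) =
    D%:R *: (map_mx ratr V *m
      (map_mx ratr b - map_mx ratr Ax *m natpt R n -
       map_mx ratr Az *m int_vec R z)).
  rewrite /int_vec !map_mxB map_mxM raddfMn/= (DR _ _ _ Eb) (DR _ _ _ Ex) (DR _ _ _ Ez).
  rewrite !map_mxM !mulmxBr !scalerBr -!scalemxAl !mulmxA; congr (_ - _ - _).
  rewrite [natpt R n]mx11_scalar mul_mx_scalar mxE.
  by rewrite -scaler_nat scalerA mulrC -scalerA.
have WE' z i : 0 <= (lsubmx W - lsubmx (rsubmx W) *+ n - rsubmx (rsubmx W) *m z) i 0 =
    (0 <= (map_mx ratr V *m
      (map_mx ratr b - map_mx ratr Ax *m natpt R n -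
       map_mx ratr Az *m int_vec R z)) i 0).
  have /matrixP/(_ i 0) := WE z; rewrite [LHS]mxE [RHS]mxE => E.
  by rewrite -(ler0z R) E pmulr_rge0// ltr0n.
split=> -[z Hz]; exists z.
  by move=> i; rewrite WE'; move: i; apply/HV.
by apply/HV => i; rewrite -WE'.
Qed.

Lemma MILP_periodic (R : realType) (S : set 'cV[R]_1) :
  S `<=` posnats R -> infinite_set S -> rational_MILP_R S -> periodic_set S.
Proof.
move=> SN Sinf [p [d [M [MS Mrat]]]].
have [m [beta [xi [Z SE]]]] := MILP_integer_slices Mrat MS.
have [|q q0 Sq] := infinite_integer_slices _ SE.
  move=> Pfin; apply: Sinf.
  apply: sub_finite_set (finite_image (natpt R) Pfin) => x Sx.
  by have [n _ En] := SN _ Sx; exists n => //=; rewrite /natpt En.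
exists (natpt R q); first by apply: contraTneq q0 => /(@natpt_inj R _ 0%N) ->.
move=> x k Sx _; have [n _ En] := SN _ Sx.
have -> : x + k%:R *: natpt R q = natpt R (n + k * q).
  by rewrite -En; apply/matrixP => i j; rewrite !mxE natrD natrM.
by apply: (shift_closed_mul _ Sq); rewrite /natpt/= En.
Qed.

(** * Closed convex sets and rational polyhedra *)
Definition closed_convex (R : realType) (k : nat) (M : set 'cV[R]_k) : Prop :=
  closed M /\ convex_set (M : set (convex_lmodType 'cV[R]_k)).

Lemma closed_convex_bigcap (R : realType) (k : nat) (J : Type)
    (M : J -> set 'cV[R]_k) :
  (forall j, closed_convex (M j)) -> closed_convex (\bigcap_j M j).
Proof.
move=> Mcc; split; first by apply: closed_bigI => j _; case: (Mcc j).
move=> x y t; rewrite !inE => Mx My j _.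
have [_ /(_ x y t)] := Mcc j; rewrite !inE; apply; [exact: Mx|exact: My].
Qed.

Lemma closed_convexI (R : realType) (k : nat) (M N : set 'cV[R]_k) :
  closed_convex M -> closed_convex N -> closed_convex (M `&` N).
Proof.
by move=> Mcc Ncc; rewrite -bigcap2E; apply: closed_convex_bigcap => -[|[|n]] //=;
  split=> [|x y t _ _]; [exact: closedT|rewrite inE].
Qed.

Lemma closed_convex_halfspace (R : realType) (k : nat) (a : 'rV[R]_k) (b : R) :
  closed_convex [set w | (a *m w) 0 0 <= b].
Proof.
split; last first.
  move=> x y t; rewrite !inE /= => ax ay.
  have -> : (a *m conv t x y) 0 0 =
      t%:num * (a *m x) 0 0 + (1 - t%:num) * (a *m y) 0 0.
    rewrite [conv t x y]/(t%:num *: x + (1 - t%:num) *: y).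
    by rewrite mulmxDr -!scalemxAr [LHS]mxE; congr (_ + _); rewrite [LHS]mxE.
  have t0 : 0 <= t%:num by [].
  have t1 : t%:num <= 1 by [].
  nra.
have -> : [set w : 'cV[R]_k | (a *m w) 0 0 <= b] =
    (fun w => \sum_j a 0 j * w j 0) @^-1` [set r | r <= b].
  by apply/seteqP; split=> w /=; rewrite mxE.
apply: preimage_closed; last exact: closed_le.
move=> w _; move: w.
apply: (@continuous_big R^o _ +%R 0).
  by move=> x; apply: cvgD; [exact: cvg_fst|exact: cvg_snd].
move=> j _ w.
apply: (@continuous_comp _ _ _ (fun w : 'cV[R]_k => w j 0) ( *%R (a 0 j)) w).
  exact: coord_continuous.
exact: mulrl_continuous.
Qed.

Lemma rational_polyhedron_closed_convex (R : realType) (k : nat)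
    (M : set 'cV[R]_k) : rational_polyhedron M -> closed_convex M.
Proof.
move=> [m [A [b ->]]].
rewrite [X in closed_convex X](_ : _ = \bigcap_i
    [set w | (row i (map_mx ratr A) *m w) 0 0 <= ratr (b i 0)]).
  by apply: closed_convex_bigcap => i; exact: closed_convex_halfspace.
have rowE w i : (row i (map_mx ratr A) *m w) 0 0 = (map_mx ratr A *m w) i 0 :> R.
  by rewrite -row_mul mxE.
by apply/seteqP; split=> w H i; [move=> _ /=; rewrite rowE|rewrite -rowE]; apply: H.
Qed.

Lemma rational_polyhedronI (R : realType) (k : nat) (M N : set 'cV[R]_k) :
  rational_polyhedron M -> rational_polyhedron N -> rational_polyhedron (M `&` N).
Proof.
move=> [m [A [b ->]]] [m' [A' [b' ->]]].
exists (m + m')%N, (col_mx A A'), (col_mx b b').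
apply/seteqP; split=> w /=; rewrite map_col_mx mul_col_mx.
  move=> [H H'] i; case: (split_ordP i) => j ->; first by rewrite !col_mxEu.
  by rewrite !col_mxEd.
by move=> H; split=> i; [have := H (lshift _ i)|have := H (rshift _ i)];
  rewrite ?col_mxEu ?col_mxEd.
Qed.

Lemma rational_polyhedron_ge0 (R : realType) (m k : nat) (A : 'M[rat]_(m, k)) :
  rational_polyhedron [set w : 'cV[R]_k | forall i, 0 <= (map_mx ratr A *m w) i 0].
Proof.
have signE (w : 'cV[R]_k) i :
    ((map_mx ratr (- A) *m w) i 0 <= ratr ((0 : 'cV[rat]_m) i 0)) =
    (0 <= (map_mx ratr A *m w) i 0).
  by rewrite map_mxN mulNmx [X in X <= _]mxE [X in ratr X]mxE raddf0 oppr_le0.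
by exists m, (- A), 0; apply/seteqP; split=> w H i; have := H i; rewrite /= signE.
Qed.

Lemma rational_polyhedron_eq (R : realType) (m k : nat) (A : 'M[rat]_(m, k))
    (b : 'cV[rat]_m) :
  rational_polyhedron [set w : 'cV[R]_k | map_mx ratr A *m w = map_mx ratr b].
Proof.
rewrite [X in rational_polyhedron X](_ : _ =
    [set w | forall i, (map_mx ratr A *m w) i 0 <= ratr (b i 0)] `&`
    [set w | forall i, (map_mx ratr (- A) *m w) i 0 <= ratr ((- b) i 0)]).
  by apply: rational_polyhedronI; [exists m, A, b | exists m, (- A), (- b)].
apply/seteqP; split=> [w Ew|w [le1 le2]].
  split=> i; first by rewrite Ew mxE.
  by rewrite map_mxN mulNmx Ew !mxE raddfN.
apply/colP => i; apply/le_anti; rewrite [X in _ <= X <= _]mxE le1 /=.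
have := le2 i; rewrite map_mxN mulNmx [X in X <= _]mxE [X in _ <= ratr X]mxE.
by rewrite raddfN lerN2 mxE.
Qed.

(** * The index set of a union of progressions *)

(** The product of a half-line and a simplex. Its integer points are the pairs of
    a natural number [q] and a vertex [i]: they can index the element with
    number [q] of the progression with number [i]. *)
Definition halfline_simplex (R : realType) (m : nat) : set 'cV[R]_(1 + m) :=
  [set z : 'cV[R]_(1 + m) | (forall i, 0 <= z i 0) /\ \sum_i dsubmx z i 0 = 1].
Arguments halfline_simplex R m : clear implicits.

Lemma rational_polyhedron_halfline_simplex (R : realType) (k m : nat) :
  rational_polyhedron
    [set w : 'cV[R]_(k + (1 + m)) | halfline_simplex R m (dsubmx w)].
Proof.
pose P : 'M[rat]_(1 + m, k + (1 + m)) := row_mx 0 1%:M.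
pose E : 'M[rat]_(1, k + (1 + m)) := row_mx 0 (row_mx 0 (const_mx 1)).
rewrite [X in rational_polyhedron X](_ : _ =
    [set w | forall i, 0 <= (map_mx ratr P *m w) i 0] `&`
    [set w | map_mx ratr E *m w = map_mx ratr 1%:M]).
  by apply: rational_polyhedronI;
    [exact: rational_polyhedron_ge0 | exact: rational_polyhedron_eq].
have PE (w : 'cV[R]_(k + (1 + m))) : map_mx ratr P *m w = dsubmx w.
  rewrite -[w in LHS]vsubmxK map_row_mx mul_row_col map_mx0 map_mx1.
  by rewrite mul0mx mul1mx add0r.
have EE (w : 'cV[R]_(k + (1 + m))) :
    map_mx ratr E *m w = (const_mx 1 : 'rV_m) *m dsubmx (dsubmx w).
  rewrite -[w in LHS]vsubmxK -[dsubmx w in LHS]vsubmxK.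
  rewrite !map_row_mx !mul_row_col.
  by rewrite !map_mx0 !mul0mx !add0r map_const_mx rmorph1.
have sumE (v : 'cV[R]_m) : (const_mx 1 : 'rV_m) *m v = (\sum_i v i 0)%:M.
  apply/matrixP => i j; rewrite !ord1 !mxE eqxx mulr1n.
  by apply: eq_bigr => l _; rewrite mxE mul1r.
apply/seteqP; split=> w /= [H1 H2]; rewrite PE EE map_mx1 sumE in H1 H2 *.
  by rewrite H2.
by split=> //; move/matrixP/(_ 0 0): H2; rewrite !mxE eqxx !mulr1n.
Qed.

Lemma halfline_simplex_vertex (R : realType) (m q : nat) (i : 'I_m) :
  exists2 z : 'cV[int]_(1 + m), int_vec R z = col_mx (natpt R q) (delta_mx i 0) &
    halfline_simplex R m (int_vec R z).
Proof.
have E : int_vec R (col_mx (const_mx q%:Z) (delta_mx i 0)) =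
    col_mx (natpt R q) (delta_mx i 0).
  by rewrite /int_vec map_col_mx map_delta_mx map_const_mx.
exists (col_mx (const_mx q%:Z) (delta_mx i 0)) => //; rewrite E; split.
  move=> j; case: (split_ordP j) => l ->; by rewrite ?col_mxEu ?col_mxEd !mxE ler0n.
rewrite (bigD1 i)//= big1 ?addr0 => [|j ji]; rewrite col_mxKd mxE ?eqxx//.
by rewrite (negbTE ji).
Qed.

Lemma halfline_simplex_integer (R : realType) (m : nat) (z : 'cV[int]_(1 + m)) :
  halfline_simplex R m (int_vec R z) ->
  exists (q : nat) (i : 'I_m), int_vec R z = col_mx (natpt R q) (delta_mx i 0).
Proof.
move=> [z0 z1]; have {}z0 i : 0 <= z i 0 by have := z0 i; rewrite mxE ler0z.
have {z1} sum1 : \sum_i dsubmx z i 0 = 1.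
  apply: (@intr_inj R); rewrite -[RHS]z1 rmorph_sum/=.
  by apply: eq_bigr => i _; rewrite !mxE.
have [i zi] : exists i, dsubmx z i 0 != 0.
  apply: contrapT => H; move/eqP: sum1; rewrite big1// => i _.
  by apply: contrapT => /eqP zi; apply: H; exists i.
have d0 j : 0 <= dsubmx z j 0 by rewrite mxE.
have di1 : 1 <= dsubmx z i 0 by rewrite -gtz0_ge1 lt_def zi d0.
have others j : j != i -> dsubmx z j 0 = 0.
  move=> ji; move: sum1; rewrite (bigD1 i)//= (bigD1 j)//=.
  have := d0 j; have : 0 <= \sum_(l < m | (l != i) && (l != j)) dsubmx z l 0.
    by apply: sumr_ge0.
  lra.
have zi1 : dsubmx z i 0 = 1.
  by rewrite -sum1 (bigD1 i)//= big1 ?addr0.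
exists `|z (lshift m ord0) ord0|%N, i.
rewrite -[z in LHS]vsubmxK /int_vec map_col_mx; congr col_mx.
  apply/matrixP => a b; rewrite !mxE !ord1.
  by rewrite natr_absz ger0_norm.
apply/colP => j; rewrite mxE [RHS]mxE eqxx andbT.
by have [->|/others ->] := eqVneq j i; rewrite ?zi1.
Qed.

(** The simplex is bounded, so everything depends on the image of the direction
    [e] of the half-line: if it is zero the image of the product is bounded, and
    otherwise a multiple of it is an integer recession direction. *)
Lemma rationally_unbounded_halfline_simplex (R : realType) (m : nat) :
  rationally_unbounded (halfline_simplex R m).
Proof.
move=> d A b I'; pose e : 'cV[rat]_(1 + m) := col_mx 1 0.
have AE (z : 'cV[R]_(1 + m)) : map_mx ratr A *m z =
    z (lshift m ord0) ord0 *: map_mx ratr (A *m e) +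
    map_mx ratr (rsubmx A) *m dsubmx z.
  rewrite -{1 2}[A]hsubmxK -[z in LHS]vsubmxK map_row_mx !mul_row_col.
  rewrite mulmx0 addr0 mulmx1.
  congr (_ + _); rewrite [usubmx z]mx11_scalar mul_mx_scalar; congr (_ *: _).
  by rewrite mxE; congr (z _ _); apply/val_inj.
have [Ae0|Ae0] := eqVneq (A *m e) 0; [left|right].
  pose K := \sum_i ((\sum_j `|map_mx (@ratr R) (rsubmx A) i j|) + `|ratr (b i 0) : R|).
  exists K; split; first exact: num_real.
  move=> M KM _ [z [z0 z1] <-]; move: (ltW KM); apply: le_trans.
  rewrite [leLHS]mx_normrE.
  have K0 : 0 <= K.
    by apply: sumr_ge0 => i _; apply: addr_ge0 => //; apply: sumr_ge0.
  apply/bigmax_leP; split=> // -[i j] _ /=.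
  rewrite {}[j]ord1 AE Ae0 raddf0 scaler0 add0r.
  rewrite /K (bigD1 i)//=; apply: ler_wpDr.
    by apply: sumr_ge0 => l _; apply: addr_ge0 => //; apply: sumr_ge0.
  rewrite mxE; apply: le_trans (ler_normD _ _) _; apply: lerD; last by rewrite mxE.
  rewrite mxE; apply: le_trans (ler_norm_sum _ _ _) _; apply: ler_sum => l _.
  rewrite normrM ler_piMr// ger0_norm; last by rewrite mxE.
  by rewrite -z1 (bigD1 l)//= lerDl; apply: sumr_ge0 => t _; rewrite mxE.
have [D D0 [r Er]] := clear_denominators (A *m e).
have ErR : int_vec R r = D%:R *: map_mx ratr (A *m e).
  have := congr1 (map_mx (@ratr R)) Er; rewrite ratr_map_intr map_mxZ/= ratr_nat.
  by move=> ->.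
have DR : D%:R != 0 :> R by rewrite pnatr_eq0 -lt0n.
exists (int_vec R r); split; first by exists r.
split.
  move=> x lam [z [z0 z1] <-] lam0.
  exists (z + col_mx (lam * D%:R)%:M 0).
    split=> [i|]; last by rewrite [dsubmx _]raddfD/= col_mxKd addr0.
    rewrite mxE addr_ge0//; case: (split_ordP i) => j ->.
      by rewrite col_mxEu !ord1 mxE eqxx mulr1n mulr_ge0.
    by rewrite col_mxEd mxE.
  rewrite mulmxDr (AE (col_mx _ _)) col_mxKd mulmx0 addr0 col_mxEu mxE eqxx mulr1n.
  by rewrite ErR scalerA addrAC.
rewrite ErR => /eqP; rewrite scaler_eq0 (negbTE DR)/= => /eqP H.
by move/eqP: Ae0; apply; apply: (@map_mx_inj _ _ (@ratr R)); rewrite H raddf0.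
Qed.

(** * Formulations of unions of progressions *)
Lemma mul_row_vertex (T : pzRingType) (m : nat) (s : 'rV[T]_m) (i : 'I_m) :
  s *m delta_mx i 0 = (s 0 i)%:M.
Proof. by rewrite -colE; apply/matrixP => j l; rewrite !ord1 !mxE eqxx mulr1n. Qed.

Lemma natpt_scalar (R : realType) (n : nat) : natpt R n = n%:R%:M.
Proof. by apply/matrixP => i j; rewrite !ord1 !mxE eqxx mulr1n. Qed.

Lemma rational_MILP_progressions (R : realType) (m u : nat) (s : 'I_m -> nat) :
  rational_MILP_R [set natpt R (s iq.1 + iq.2 * u) | iq in [set: 'I_m * nat]].
Proof.
pose sigma : 'rV[rat]_m := \row_i (s i)%:R.
pose E : 'M[rat]_(1, 1 + 0 + (1 + m)) :=
  row_mx (row_mx 1%:M 0) (row_mx (- u%:R%:M) (- sigma)).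
pose M : set 'cV[R]_(1 + 0 + (1 + m)) :=
  [set w | halfline_simplex R m (dsubmx w)] `&`
  [set w | map_mx ratr E *m w = map_mx ratr 0].
have Mrat : rational_polyhedron M.
  apply: rational_polyhedronI; last exact: rational_polyhedron_eq.
  exact: rational_polyhedron_halfline_simplex.
have [Mcl Mcvx] := rational_polyhedron_closed_convex Mrat.
have ME x y q i : map_mx ratr E *m
      (col_mx (col_mx x y) (col_mx (natpt R q) (delta_mx i 0))) =
    x - natpt R (s i + q * u).
  rewrite !map_row_mx !mul_row_col map_mx1 mul1mx map_mx0 mul0mx addr0.
  rewrite !map_mxN !mulNmx -opprD map_scalar_mx rmorph_nat mul_scalar_mx mul_row_vertex.
  congr (_ - _); rewrite !natpt_scalar scale_scalar_mx -raddfD/=; congr _%:M.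
  by rewrite !mxE ratr_nat natrD natrM addrC mulrC.
exists 0%N, (1 + m)%N, M; split=> //; split=> // x; split.
  move=> [[i q] _ /= <-]; have [z Ez Dz] := halfline_simplex_vertex R q i.
  exists 0, z; split; first by rewrite /= col_mxKd.
  by rewrite /= Ez ME subrr raddf0.
move=> [y [z [/=]]]; rewrite col_mxKd => /halfline_simplex_integer[q [i ->]].
rewrite ME raddf0 => /eqP; rewrite subr_eq0 => /eqP ->.
by exists (i, q).
Qed.

Lemma affine_ge0_slope (R : realType) (a c : R) :
  (forall al, 0 <= al * a + c) -> a = 0.
Proof.
move=> H; apply/eqP; apply: contraT => a0.
by have := H (- (c + 1) / a); rewrite divfK//; lra.
Qed.

Definition pt_col (T : pzRingType) (m : nat) (x v y w : T) (ze : 'cV[T]_m) :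
    'cV[T]_(1 + 2 + (1 + m)) :=
  col_mx (col_mx x%:M (col_mx v%:M y%:M : 'cV_(1 + 1))) (col_mx w%:M ze).

Definition pt_row (T : pzRingType) (m : nat) (a b c e : T) (r : 'rV[T]_m) :
    'rV[T]_(1 + 2 + (1 + m)) :=
  row_mx (row_mx a%:M (row_mx b%:M c%:M : 'rV_(1 + 1))) (row_mx e%:M r).

Lemma mul_pt_row (T : pzRingType) (m : nat) (a b c e x v y w : T)
    (r : 'rV[T]_m) (ze : 'cV[T]_m) :
  (pt_row a b c e r *m pt_col x v y w ze) 0 0 =
  a * x + (b * v + c * y) + (e * w + (r *m ze) 0 0).
Proof.
rewrite /pt_row /pt_col !mul_row_col (@mul_row_col _ 1 1 1 1).
rewrite -!scalar_mxM.
by move: (r *m ze) => rz; rewrite !mxE eqxx !mulr1n.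
Qed.

Lemma map_pt_row (R : realType) (m : nat) (a b c e : rat) (r : 'rV[rat]_m) :
  map_mx ratr (pt_row a b c e r) =
  pt_row (ratr a) (ratr b) (ratr c) (ratr e) (map_mx ratr r) :> 'M[R]_(_, _).
Proof. by rewrite /pt_row !map_row_mx (@map_row_mx _ _ _ 1 1 1) !map_scalar_mx /=. Qed.

Lemma pt_colP (T : pzRingType) (m : nat) (w : 'cV[T]_(1 + 2 + (1 + m))) :
  w = pt_col (usubmx (usubmx w) 0 0) (usubmx (dsubmx (usubmx w) : 'cV_(1 + 1)) 0 0)
    (dsubmx (dsubmx (usubmx w) : 'cV_(1 + 1)) 0 0) (usubmx (dsubmx w) 0 0)
    (dsubmx (dsubmx w)).
Proof. by rewrite /pt_col -!mx11_scalar !vsubmxK. Qed.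

(** In the coordinates of [pt_col x v y w ze], write [tau] for the sum of the
    [ze i] with [b i]. The formulation needs [v = w] when [tau = 1] and [v = 0]
    when [tau = 0], with [w >= 0] unbounded in both cases. The closed convex hull
    of these triples [(tau, v, w)] has unwanted points with [tau = 0], such as
    [(0, c, c)], the limit of [(tau, c, c)], which is the combination with weight
    [tau] of [(1, c / tau, c / tau)] and [(0, 0, 0)]. An auxiliary coordinate [y]
    of the order of [w ^ 2] sends such combinations to infinity: the constraints
    are [v ^ 2 <= y tau] and [(w - v) ^ 2 <= y (1 - tau)]. Each is written as a
    family of linear inequalities in [al], which says that a quadratic polynomial
    in [al] is nonnegative. *)
Definition switch_set (R : realType) (m u : nat) (s : 'I_m -> nat)
    (b : 'I_m -> bool) : set 'cV[R]_(1 + 2 + (1 + m)) :=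
  let sigma : 'rV[rat]_m := \row_i (s i)%:R in
  let tau c : 'rV[R]_m := \row_i (b i == c)%:R in
  [set w | halfline_simplex R m (dsubmx w)] `&`
  [set w | map_mx ratr (pt_row 1 (- u%:R) 0 0 (- sigma)) *m w =
           map_mx ratr 0] `&`
  \bigcap_al (
    [set w | (pt_row 0 (al *+ 2) (-1) 0
                (- al ^+ 2 *: tau true) *m w) 0 0 <= 0] `&`
    [set w | (pt_row 0 (- (al *+ 2)) (-1) (al *+ 2)
                (- al ^+ 2 *: tau false) *m w) 0 0 <= 0]).

Arguments switch_set R {m} u s b.

Lemma switch_set_closed_convex (R : realType) (m u : nat) (s : 'I_m -> nat)
    (b : 'I_m -> bool) : closed_convex (switch_set R u s b).
Proof.
apply: closed_convexI; last first.
  apply: closed_convex_bigcap => al.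
  by apply: closed_convexI; exact: closed_convex_halfspace.
apply: rational_polyhedron_closed_convex; apply: rational_polyhedronI.
  exact: rational_polyhedron_halfline_simplex.
exact: rational_polyhedron_eq.
Qed.

Lemma switch_setE (R : realType) (m u : nat) (s : 'I_m -> nat)
    (b : 'I_m -> bool) (x v y w : R) (ze : 'cV[R]_m) :
  switch_set R u s b (pt_col x v y w ze) <->
  [/\ halfline_simplex R m (col_mx w%:M ze),
      x = u%:R * v + \sum_i (s i)%:R * ze i 0 &
      forall al, al *+ 2 * v <= y + al ^+ 2 * \sum_(i | b i) ze i 0 /\
        al *+ 2 * (w - v) <= y + al ^+ 2 * \sum_(i | ~~ b i) ze i 0].
Proof.
have tauE c : ((\row_i (b i == c)%:R : 'rV[R]_m) *m ze) 0 0 =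
    \sum_(i | b i == c) ze i 0.
  rewrite mxE [RHS]big_mkcond/=; apply: eq_bigr => i _; rewrite mxE.
  by case: (_ == _); rewrite ?mul1r ?mul0r.
have tauT : \sum_(i | b i == true) ze i 0 = \sum_(i | b i) ze i 0.
  by apply: eq_bigl => i; case: (b i).
have tauF : \sum_(i | b i == false) ze i 0 = \sum_(i | ~~ b i) ze i 0.
  by apply: eq_bigl => i; case: (b i).
have sE : (map_mx ratr (\row_i (s i)%:R : 'rV[rat]_m) *m ze) 0 0 =
    \sum_i (s i)%:R * ze i 0.
  by rewrite mxE; apply: eq_bigr => i _; rewrite !mxE ratr_nat.
pose eq_row : 'rV[rat]_(1 + 2 + (1 + m)) :=
  pt_row 1 (- u%:R) 0 0 (- (\row_i (s i)%:R)).
have eqE : map_mx ratr eq_row *m pt_col x v y w ze = map_mx ratr 0 <->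
    x = u%:R * v + \sum_i (s i)%:R * ze i 0.
  have E : (map_mx ratr eq_row *m pt_col x v y w ze) 0 0 =
      x - (u%:R * v + \sum_i (s i)%:R * ze i 0).
    rewrite map_pt_row mul_pt_row map_mxN mulNmx [X in _ + (_ + X)]mxE sE.
    by rewrite raddfN/= ratr_nat rmorph1 rmorph0; ring.
  split=> [/matrixP/(_ 0 0)|Ex].
    by rewrite E [RHS]mxE mxE raddf0 => /eqP; rewrite subr_eq0 => /eqP.
  by apply/matrixP => i j; rewrite !ord1 E Ex subrr !mxE raddf0.
have ineqE al : (pt_row 0 (al *+ 2) (-1) 0
        (- al ^+ 2 *: \row_i (b i == true)%:R) *m pt_col x v y w ze) 0 0 <= 0 <->
      al *+ 2 * v <= y + al ^+ 2 * \sum_(i | b i) ze i 0.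
  rewrite mul_pt_row -scalemxAl [X in _ + (_ + X)]mxE tauE tauT; split; lra.
have ineqE' al : (pt_row 0 (- (al *+ 2)) (-1) (al *+ 2)
        (- al ^+ 2 *: \row_i (b i == false)%:R) *m pt_col x v y w ze) 0 0 <= 0 <->
      al *+ 2 * (w - v) <= y + al ^+ 2 * \sum_(i | ~~ b i) ze i 0.
  rewrite mul_pt_row -scalemxAl [X in _ + (_ + X)]mxE tauE tauF; split; lra.
split=> [[[/= H1 H2] H3]|[H1 H2 H3]].
  split; [by move: H1; rewrite col_mxKd | exact/eqE |].
  by move=> al; have [/ineqE ? /ineqE' ?] := H3 al I.
split; first by split=> /=; [rewrite col_mxKd|apply/eqE].
by move=> al _; have [? ?] := H3 al; split; [apply/ineqE|apply/ineqE'].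
Qed.

Lemma sum_delta (R : realType) (m : nat) (i : 'I_m) (P : pred 'I_m) :
  \sum_(j | P j) (delta_mx i 0 : 'cV[R]_m) j 0 = (P i)%:R.
Proof.
rewrite big_mkcond/= (bigD1 i)//= big1 => [|j ji]; rewrite mxE ?eqxx.
  by rewrite addr0; case: (P i).
by rewrite (negbTE ji); case: (P j).
Qed.

Lemma sum_weighted_delta (R : realType) (m : nat) (i : 'I_m) (f : 'I_m -> R) :
  \sum_j f j * (delta_mx i 0 : 'cV[R]_m) j 0 = f i.
Proof.
rewrite (bigD1 i)//= big1 => [|j ji]; rewrite mxE ?eqxx ?mulr1 ?addr0//.
by rewrite (negbTE ji) mulr0.
Qed.

(** Every point [(w, ze)] of the half-line times the simplex lifts to
    [switch_set], with [v = t w] and [y = w ^ 2]: the two inequalities become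
    [0 <= t (al - w) ^ 2 + (1 - t) w ^ 2] and the same with [t] replaced by
    [1 - t]. *)
Lemma switch_set_point (R : realType) (m u : nat) (s : 'I_m -> nat)
    (b : 'I_m -> bool) (w : R) (ze : 'cV[R]_m) :
  halfline_simplex R m (col_mx w%:M ze) ->
  let t := \sum_(i | b i) ze i 0 in
  switch_set R u s b
    (pt_col (u%:R * (t * w) + \sum_i (s i)%:R * ze i 0) (t * w) (w ^+ 2) w ze).
Proof.
move=> Dz t; apply/switch_setE; split=> // al.
have [z0 z1] := Dz; rewrite col_mxKd in z1.
have ze0 i : 0 <= ze i 0 by have := z0 (rshift 1 i); rewrite col_mxEd.
pose t' := \sum_(i | ~~ b i) ze i 0.
have tt' : t + t' = 1 by rewrite -z1 (bigID b).
have t0 : 0 <= t by apply: sumr_ge0.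
have t'0 : 0 <= t' by apply: sumr_ge0.
rewrite -/t -/t'; move: t t' tt' t0 t'0 => t t' /(canRL (addKr _)).
rewrite addrC => -> t0 t'0.
have H1 : 0 <= t * (al - w) ^+ 2 by rewrite mulr_ge0// sqr_ge0.
have H2 : 0 <= (1 - t) * w ^+ 2 by rewrite mulr_ge0// sqr_ge0.
have H3 : 0 <= (1 - t) * (al - w) ^+ 2 by rewrite mulr_ge0// sqr_ge0.
have H4 : 0 <= t * w ^+ 2 by rewrite mulr_ge0// sqr_ge0.
by split; lra.
Qed.

Lemma index_set_switch_set (R : realType) (m u : nat) (s : 'I_m -> nat)
    (b : 'I_m -> bool) :
  index_set (switch_set R u s b) = halfline_simplex R m.
Proof.
apply/seteqP; split=> [_ [w [[Dw _] _] <-]//|z Dz].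
have Ez : z = col_mx (usubmx z 0 0)%:M (dsubmx z) by rewrite -mx11_scalar vsubmxK.
rewrite Ez in Dz; eexists; first exact: (switch_set_point u s b Dz).
by rewrite [in RHS]Ez [LHS]col_mxKd.
Qed.

(** The progressions with [b i = false] are cut down to their first element. At
    a vertex one of the two sums in the quadratic constraints is zero, and a
    quadratic polynomial in [al] without square term is nonnegative only if it
    is constant: this forces [v = q] if [b i] and [v = 0] otherwise. *)
Lemma rational_MICP_progressions (R : realType) (m u : nat)
    (s : 'I_m -> nat) (b : 'I_m -> bool) :
  rational_MICP_R
    [set natpt R (s iq.1 + b iq.1 * (iq.2 * u)) | iq in [set: 'I_m * nat]].
Proof.
exists 2%N, (1 + m)%N, (switch_set R u s b); split; last first.
  by rewrite index_set_switch_set; exact: rationally_unbounded_halfline_simplex.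
have [Mcl Mcvx] := switch_set_closed_convex R u s b.
split=> // x; split.
  move=> [[i q] _ /= <-]; have [z Ez Dz] := halfline_simplex_vertex R q i.
  rewrite Ez natpt_scalar in Dz; have /= := switch_set_point u s b Dz.
  rewrite sum_delta (@sum_weighted_delta R _ _ (fun i => (s i)%:R)).
  set v := _ * q%:R; rewrite /pt_col => Mw.
  exists (col_mx v%:M (q%:R ^+ 2)%:M : 'cV_(1 + 1)), z; rewrite Ez !natpt_scalar.
  rewrite (_ : (s i + b i * (q * u))%:R = u%:R * v + (s i)%:R)//.
  by rewrite /v natrD !natrM; ring.
move=> [y [z Mw]].
have [q [i Ez]] : exists q i, int_vec R z = col_mx (natpt R q) (delta_mx i 0).
  apply: halfline_simplex_integer; rewrite -(index_set_switch_set R u s b).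
  by eexists; [exact: Mw | rewrite col_mxKd].
rewrite (pt_colP (col_mx _ _)) Ez !col_mxKu !col_mxKd col_mxKu in Mw.
move/switch_setE: Mw; set v := usubmx _ 0 0; set y' := dsubmx _ 0 0.
rewrite [natpt R q 0 0]mxE !sum_delta (@sum_weighted_delta R _ _ (fun i => (s i)%:R)).
move=> [_ Ex Hal].
exists (i, q) => //=; rewrite natpt_scalar [RHS]mx11_scalar Ex.
suff -> : v = (b i)%:R * q%:R by congr _%:M; rewrite natrD !natrM; ring.
case: (b i) Hal => /= Hal.
- suff : - 2 * (q%:R - v) = 0 by lra.
  apply: (@affine_ge0_slope _ _ y') => al; have [_] := Hal al; lra.
- suff : - 2 * v = 0 by lra.
  apply: (@affine_ge0_slope _ _ y') => al; have [+ _] := Hal al; lra.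
Qed.

Lemma finite_natpts (R : realType) (T : set 'cV[R]_1) :
  T `<=` posnats R -> finite_set T ->
  exists l : seq nat, T = natpt R @` [set` l].
Proof.
move=> TN Tfin.
have /finite_seqP[l El] := finite_image (fun x : 'cV[R]_1 => Num.truncn (x 0 0)) Tfin.
have truncE x : T x -> natpt R (Num.truncn (x 0 0)) = x.
  by move=> /TN[n _ <-]; rewrite mxE natrK.
exists l; rewrite -El; apply/seteqP; split=> [x Tx|_ [_ [x Tx <-] <-]].
  by exists (Num.truncn (x 0 0)); [exists x | exact: truncE].
by rewrite truncE.
Qed.

Lemma minkowski_sum_progression (R : realType) (l : seq nat) (u : nat) :
  minkowski_sum (natpt R @` [set` l])
    (int_vec R @` intcone [fset const_mx u%:Z]%fset) =
  [set natpt R (nth 0%N l iq.1 + iq.2 * u) | iq in [set: 'I_(size l) * nat]].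
Proof.
rewrite intcone_single; apply/seteqP; split.
  move=> _ [_ [n /= nl <-] [_ [q _ <-] <-]].
  have ltn : (index n l < size l)%N by rewrite index_mem.
  exists (Ordinal ltn, q) => //=; rewrite nth_index//.
  by apply/matrixP => i j; rewrite !mxE natrD.
move=> _ [[i q] _ /= <-]; exists (natpt R (nth 0%N l i)).
  by exists (nth 0%N l i) => //=; exact: mem_nth.
exists (natpt R (q * u)); first by exists q.
by apply/matrixP => a b; rewrite !mxE natrD.
Qed.

Lemma setU_progressions (R : realType) (l1 l0 : seq nat) (u : nat) :
  natpt R @` [set` l1] `|`
  [set natpt R (nth 0%N l0 iq.1 + iq.2 * u) | iq in [set: 'I_(size l0) * nat]] =
  [set natpt R (nth 0%N (l1 ++ l0) iq.1 + (size l1 <= iq.1)%N * (iq.2 * u)) |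
    iq in [set: 'I_(size (l1 ++ l0)) * nat]].
Proof.
apply/seteqP; split=> [x [[n /= nl <-]|[[i q] _ /= <-]]|_ [[i q] _ /= <-]].
- have lt1 : (index n l1 < size l1)%N by rewrite index_mem.
  have lt : (index n l1 < size (l1 ++ l0))%N by rewrite size_cat ltn_addr.
  exists (Ordinal lt, 0%N) => //=.
  by rewrite nth_cat lt1 nth_index// leqNgt lt1 mul0n addn0.
- have lt : (size l1 + i < size (l1 ++ l0))%N by rewrite size_cat ltn_add2l.
  exists (Ordinal lt, q) => //=.
  by rewrite nth_cat ltnNge leq_addr/= addKn mul1n.
- rewrite nth_cat; have [lti|lei] := ltnP i (size l1).
    left; exists (nth 0%N l1 i); first exact: mem_nth.
    by rewrite mul0n addn0.
  have lt : (i - size l1 < size l0)%N.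
    by have := ltn_ord i; rewrite [X in (_ < X)%N -> _]size_cat; lia.
  by right; exists (Ordinal lt, q) => //=; rewrite mul1n.
Qed.

Theorem proposition5p5 (R : realType) (S : set 'cV[R]_1)
    (S_nat : S `<=` posnats R) (S_inf : infinite_set S) :
  [<-> (* (a) *)
       rational_MICP_R S;
       (* (b) *)
       exists S1 S2 : set 'cV[R]_1,
         [/\ S1 `<=` posnats R /\ finite_set S1,
             [/\ S2 `<=` posnats R, S2 !=set0 & periodic_set S2] &
             S = S1 `|` S2];
       (* (c) *)
       exists (S1 S0 : set 'cV[R]_1) (u0 : nat),
         [/\ S1 `<=` posnats R /\ finite_set S1,
             [/\ S0 `<=` posnats R, S0 !=set0 & finite_set S0],
             (0 < u0)%N &
             S = S1 `|` minkowski_sum S0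
                          (int_vec R @` intcone [fset const_mx u0%:Z]%fset)];
       (* (d) *)
       exists S1 S2 : set 'cV[R]_1,
         [/\ S1 `<=` posnats R /\ finite_set S1,
             [/\ S2 `<=` posnats R, infinite_set S2 & rational_MILP_R S2] &
             S = S1 `|` S2] ].
Proof.
tfae.
- exact: rational_MICP_periodic.
- move=> [S1 [S2 [S1fin [S2N S20 S2per] SE]]].
  have [S0 [u0 [? ? E2]]] := periodic_generated S2N S20 S2per.
  by exists S1, S0, u0; rewrite -E2.
- move=> [S1 [S0 [u0 [[S1N S1fin] [S0N S00 S0fin] u0_gt0 SE]]]].
  exists S1, (minkowski_sum S0 (int_vec R @` intcone [fset const_mx u0%:Z]%fset)).
  split=> //; split.
  + by move=> x S2x; apply: S_nat; rewrite SE; right.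
  + by move=> S2fin; apply: S_inf; rewrite SE; rewrite finite_setU.
  + have [l ->] := finite_natpts S0N S0fin.
    rewrite minkowski_sum_progression.
    exact: (rational_MILP_progressions R u0 (fun i : 'I_(size l) => nth 0%N l i)).
- move=> [S1 [S2 [[S1N S1fin] [S2N S2inf S2MILP] SE]]].
  have S2per := MILP_periodic S2N S2inf S2MILP.
  have S20 := infinite_setN0 S2inf.
  have [S0 [u0 [[S0N _ S0fin] _ E2]]] := periodic_generated S2N S20 S2per.
  have [l1 E1] := finite_natpts S1N S1fin.
  have [l0 E0] := finite_natpts S0N S0fin.
  rewrite SE E2 E1 E0 minkowski_sum_progression setU_progressions.
  exact: (rational_MICP_progressions R u0
    (fun i : 'I_(size (l1 ++ l0)) => nth 0%N (l1 ++ l0) i) (fun i => size l1 <= i)%N).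
Qed.
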